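(* Let $0\le k\le 1$, $0<\beta\le 1$, $\lambda\ge 0$, $0\le\nu<1$. Let $f=h+\overline g\in\mathcal H$ with $h(z)=z+\sum_{n=2}^\infty a_nz^n$ and $g(z)=\sum_{n=1}^\infty b_nz^n$, $|b_1|<1$, and suppose that $$\sum_{n=2}^\infty\phi(n,k,\lambda,\nu)|a_n|+\sum_{n=1}^\infty|\psi(n,k,\lambda,\nu)||b_n|<1-\beta,$$ where $$\phi(n,k,\lambda,\nu)=\frac{[1+\lambda(n-1)(1+nk)]\,\Gamma(n+1)\Gamma(2-\nu)}{\Gamma(n+1-\nu)},\qquad \psi(n,k,\lambda,\nu)=\frac{[1-\lambda(n+1)(1-nk)]\,\Gamma(n+1)\Gamma(2-\nu)}{\Gamma(n+1-\nu)}.$$ Then $f\in\mathcal{HM}(\beta,\lambda,k,\nu)$. The result is sharp for the function $f(z)$ given by $$f(z)=z+\sum_{n=2}^\infty\frac{\gamma_n\,\Gamma(n+1-\nu)}{[1+\lambda(n-1)(1+nk)]\Gamma(n+1)\Gamma(2-\nu)}z^n+\sum_{n=1}^\infty\frac{\delta_n\,\Gamma(n+1-\nu)}{|1-\lambda(n+1)(1-nk)|\Gamma(n+1)\Gamma(2-\nu)}\overline z^{\,n},$$ where $\sum_{n=2}^\infty|\gamma_n|+\sum_{n=1}^\infty|\delta_n|=1-\beta$.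
   Context: $\mathcal D=\{z\in\mathbb C:|z|<1\}$. $\mathcal H$ is the class of all complex-valued harmonic functions $f=h+\overline g$ that are univalent and sense preserving in $\mathcal D$, where $h(z)=z+\sum_{n=2}^\infty a_nz^n$ and $g(z)=\sum_{n=1}^\infty b_nz^n$ are analytic in $\mathcal D$ and $|b_1|<1$. For $0\le\nu<1$ the (Owa–Srivastava fractional derivative) operator $\Omega^\nu$ acts on an analytic power series by $\Omega^\nu\big(\sum_{n\ge1}c_nz^n\big)=\sum_{n\ge1}\frac{\Gamma(2-\nu)\Gamma(n+1)}{\Gamma(n+1-\nu)}c_nz^n$, and for $f=h+\overline g$ one sets $\Omega^\nu f=\Omega^\nu h+\overline{\Omega^\nu g}$. For $z=re^{i\theta}$ put $z'=\frac{\partial}{\partial\theta}(re^{i\theta})=iz$, $z''=\frac{\partial}{\partial\theta}z'=-z$, $(\Omega^\nu f)'=\frac{\partial}{\partial\theta}\Omega^\nu f(re^{i\theta})$ and $(\Omega^\nu f)''=\frac{\partial^2}{\partial\theta^2}\Omega^\nu f(re^{i\theta})$. For $0\le k\le1$, $0<\beta\le1$, $\lambda\ge0$, $0\le\nu<1$, $\mathcal{HM}(\beta,\lambda,k,\nu)$ is the class of $f\in\mathcal H$ such that $$\operatorname{Re}\left\{(1-\lambda)\frac{\Omega^\nu f}{z}+\lambda(1-k)\frac{(\Omega^\nu f)'}{z'}+\lambda k\frac{(\Omega^\nu f)''}{z''}\right\}>\beta\qquad(z=re^{i\theta}\in\mathcal D).$$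
   Formalization: Sharpness is read as: every displayed f gives equality 1−β in the coefficient sum, and for suitable arguments of γ_n, δ_n (any moduli) the infimum of the real part is exactly β (false for all arguments); δ_n=0 where 1−λ(n+1)(1−nk)=0; f is not claimed to lie in H. *)

(* Defs.v *)
From Stdlib Require Import Reals.
From Coquelicot Require Import Coquelicot.
Open Scope R_scope.

(** Euler's integral; it converges at every argument used here (all are
    positive whenever [n >= 1] and [nu < 1]). *)
Definition Gamma (x : R) : R :=
  RInt_gen (fun t => Rpower t (x - 1) * exp (- t)) (at_right 0) (Rbar_locally p_infty).

Definition disk (z : C) : Prop := Cmod z < 1.

(** Coquelicot has [Series] only for real terms. *)
Definition CSeries (u : nat -> C) : C :=
  (Series (fun n => Re (u n)), Series (fun n => Im (u n))).

Definition CPSeries (a : nat -> C) (z : C) : C :=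
  CSeries (fun n => (a n * z ^ n)%C).

Definition has_expansion (h : C -> C) (a : nat -> C) : Prop :=
  forall z, disk z -> is_pseries (K := C_AbsRing) (V := C_NormedModule) a z (h z).

(** [ex_diff_n u 2] is the C^2 condition. *)
Definition harmonic_real (u : C -> R) : Prop :=
  forall x y, disk (x, y) ->
    ex_diff_n (fun s t => u (s, t)) 2 x y /\
    partial_derive 2 0 (fun s t => u (s, t)) x y
      + partial_derive 0 2 (fun s t => u (s, t)) x y = 0.

Definition harmonic (f : C -> C) : Prop :=
  harmonic_real (fun z => Re (f z)) /\ harmonic_real (fun z => Im (f z)).

Definition univalent (f : C -> C) : Prop :=
  forall z w, disk z -> disk w -> f z = f w -> z = w.

Definition jacobian (f : C -> C) (x y : R) : R :=
  Derive (fun s => Re (f (s, y))) x * Derive (fun t => Im (f (x, t))) y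
  - Derive (fun t => Re (f (x, t))) y * Derive (fun s => Im (f (s, y))) x.

Definition sense_preserving (f : C -> C) : Prop :=
  forall x y, disk (x, y) -> 0 < jacobian f x y.

(** [f = h + conj g] with [h z = z + a_2 z^2 + ...] and [g z = b_1 z + ...]. *)
Definition canonical_rep (f h g : C -> C) (a b : nat -> C) : Prop :=
  a 0%nat = RtoC 0 /\ a 1%nat = RtoC 1 /\ b 0%nat = RtoC 0 /\
  has_expansion h a /\ has_expansion g b /\
  (forall z, disk z -> f z = (h z + Cconj (g z))%C).

Definition classH (f : C -> C) : Prop :=
  harmonic f /\ univalent f /\ sense_preserving f /\
  exists (h g : C -> C) (a b : nat -> C), canonical_rep f h g a b /\ Cmod (b 1%nat) < 1.

(** Owa-Srivastava operator, on coefficient sequences.  It is only applied to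
    sequences with zero constant term, so its factor at [n = 0] is irrelevant. *)
Definition Omega_coef (nu : R) (c : nat -> C) (n : nat) : C :=
  (RtoC (Gamma (2 - nu) * Gamma (INR n + 1) / Gamma (INR n + 1 - nu)) * c n)%C.

(** [Omega^nu f] for the harmonic [f = h + conj g] whose analytic parts have
    coefficients [a] and [b]. *)
Definition Omega (nu : R) (a b : nat -> C) (z : C) : C :=
  (CPSeries (Omega_coef nu a) z + Cconj (CPSeries (Omega_coef nu b) z))%C.

Definition polar (r theta : R) : C := (r * cos theta, r * sin theta).

Definition CDerive (F : R -> C) (t : R) : C :=
  (Derive (fun s => Re (F s)) t, Derive (fun s => Im (F s)) t).

Definition HM_re (lambda k nu : R) (a b : nat -> C) (r theta : R) : R :=
  let z := polar r in
  let W := fun t => Omega nu a b (z t) in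
  Re (RtoC (1 - lambda) * (W theta / z theta)
      + RtoC (lambda * (1 - k)) * (CDerive W theta / CDerive z theta)
      + RtoC (lambda * k) * (CDerive (CDerive W) theta / CDerive (CDerive z) theta))%C.

(** The defining quotients are meaningful only for [z <> 0], hence [0 < r].
    The coefficients [a], [b] are uniquely determined by [f]. *)
Definition classHM (beta lambda k nu : R) (f : C -> C) : Prop :=
  classH f /\
  exists (h g : C -> C) (a b : nat -> C), canonical_rep f h g a b /\
    forall r theta, 0 < r < 1 -> beta < HM_re lambda k nu a b r theta.

Definition phi (n : nat) (k lambda nu : R) : R :=
  (1 + lambda * (INR n - 1) * (1 + INR n * k)) * Gamma (INR n + 1) * Gamma (2 - nu)
  / Gamma (INR n + 1 - nu).

Definition psi (n : nat) (k lambda nu : R) : R :=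
  (1 - lambda * (INR n + 1) * (1 - INR n * k)) * Gamma (INR n + 1) * Gamma (2 - nu)
  / Gamma (INR n + 1 - nu).

(** The two weighted series, starting at [n = 2] and [n = 1] respectively. *)
Definition phi_term (k lambda nu : R) (a : nat -> C) (m : nat) : R :=
  phi (m + 2) k lambda nu * Cmod (a (m + 2)%nat).

Definition psi_term (k lambda nu : R) (b : nat -> C) (m : nat) : R :=
  Rabs (psi (m + 1) k lambda nu) * Cmod (b (m + 1)%nat).

(** Coefficients of [z^n] and of [(conj z)^n] in the extremal functions. *)
Definition ext_z (k lambda nu : R) (gamma : nat -> C) (n : nat) : C :=
  (gamma n * RtoC (Gamma (INR n + 1 - nu)
     / ((1 + lambda * (INR n - 1) * (1 + INR n * k)) * Gamma (INR n + 1) * Gamma (2 - nu))))%C.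

Definition ext_zbar (k lambda nu : R) (delta : nat -> C) (n : nat) : C :=
  (delta n * RtoC (Gamma (INR n + 1 - nu)
     / (Rabs (1 - lambda * (INR n + 1) * (1 - INR n * k)) * Gamma (INR n + 1) * Gamma (2 - nu))))%C.

Definition extremal (k lambda nu : R) (gamma delta : nat -> C) (z : C) : C :=
  (z + CSeries (fun m => ext_z k lambda nu gamma (m + 2) * z ^ (m + 2))
     + CSeries (fun m => ext_zbar k lambda nu delta (m + 1) * Cconj z ^ (m + 1)))%C.

(** Taylor coefficients of the analytic parts [h] and [g] of [extremal]; the
    conjugate appears because [extremal = h + conj g]. *)
Definition ext_a (k lambda nu : R) (gamma : nat -> C) (n : nat) : C :=
  match n with
  | O => RtoC 0
  | S O => RtoC 1
  | _ => ext_z k lambda nu gamma n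
  end.

Definition ext_b (k lambda nu : R) (delta : nat -> C) (n : nat) : C :=
  match n with
  | O => RtoC 0
  | _ => Cconj (ext_zbar k lambda nu delta n)
  end.

(** Parameters of the extremal family.  A term with vanishing denominator
    [1 - lambda (n+1) (1 - n k)] has to be absent. *)
Definition ext_params (beta lambda k : R) (gamma delta : nat -> C) : Prop :=
  (forall n, (1 <= n)%nat ->
     1 - lambda * (INR n + 1) * (1 - INR n * k) = 0 -> delta n = RtoC 0) /\
  ex_series (fun m => Cmod (gamma (m + 2)%nat)) /\
  ex_series (fun m => Cmod (delta (m + 1)%nat)) /\
  Series (fun m => Cmod (gamma (m + 2)%nat))
    + Series (fun m => Cmod (delta (m + 1)%nat)) = 1 - beta.

(* Main.v *)
Require Import Defs.
From Stdlib Require Import Reals Lra Lia Psatz.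
From Coquelicot Require Import Coquelicot.
Open Scope R_scope.

(** [Gamma], [Series] and [Derive] are total, so each limit must be shown to exist before its value
    can be used. For [Gamma] this is done only on [1, oo): there the integrand is at most K
    exp(-t/2) on the whole half-line, so one comparison settles both ends of the improper integral,
    and for n >= 1 the arguments 2-nu, n+1 and n+1-nu all exceed 1.

    Two derivatives in theta multiply the n-th coefficient by n twice. Asking that the coefficients
    stay summable against every power of n+1 gives a class closed under differentiation, so one
    differentiation lemma serves both times.

    Both halves of the theorem rest on the same non-strict bound, 1 minus the weighted coefficient
    sum. A sum below 1-beta makes it exceed beta; a sum equal to 1-beta makes it equal beta, which
    is then shown to be the infimum.

    The delicate weights in the sharpness part are the Q_n, which can vanish or be small. Eventually
    |Q_n| >= 1, so dividing by |Q_n| does not spoil summability, and where Q_n = 0 the parameter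
    delta_n is zero. *)

(** Write [c_n = Gamma(2-nu) Gamma(n+1) / Gamma(n+1-nu)].  The recursion of [Gamma]
    gives [c_1 = 1] and [1 <= c_n <= n], so [Omega^nu f] is again given by power series on
    the disk and, on a circle, both of its real components are trigonometric series with
    rapidly decreasing coefficients, which may be differentiated term by term.  With
    [P_n = 1 + lambda (n-1)(1+nk)] and [Q_n = 1 - lambda (n+1)(1-nk)] the defining
    expression becomes
      [Re (sum_n c_n P_n a_n z^(n-1) + sum_n c_n Q_n conj (b_n z^n) / z)],
    whose [n = 1] term in [a] is [1] and whose other terms are dominated by
    [phi(n) |a_n|] and [|psi(n)| |b_n|].  For sharpness one chooses the arguments of
    [gamma_n] and [delta_n] so that at [z = r] every other term equals minus its bound
    (up to a power of [r]), and lets [r] tend to [1]. *)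

(** * Euler's integral on [x >= 1] *)

(** The Cauchy criterion passes from [g] to [f], since the oscillation of [f] on [D] is at most that
    of [g]; completeness of R then gives the limit. *)
Lemma filterlim_dominated (F : (R -> Prop) -> Prop) {FF : ProperFilter F}
    (f g : R -> R) (l : R) (D : R -> Prop) :
  F D -> filterlim g F (locally l) ->
  (forall u v, D u -> D v -> Rabs (f v - f u) <= Rabs (g v - g u)) ->
  exists l', filterlim f F (locally l').
Proof.
  intros HD Hg Hfg.
  apply (filterlim_locally_cauchy (U := R_CompleteSpace)).
  assert (Hc := proj2 (filterlim_locally_cauchy (F := F) (U := R_CompleteSpace) g)
                  (ex_intro _ l Hg)).
  intros eps; destruct (Hc eps) as [P [HP Hball]].
  exists (fun t => P t /\ D t); split.
  - now apply filter_and.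
  - intros u v [Pu Du] [Pv Dv].
    eapply Rle_lt_trans; [apply (Hfg u v Du Dv) | apply (Hball u v Pu Pv)].
Qed.

Lemma at_right_0_pos : at_right 0 (fun t => 0 < t).
Proof. exists (mkposreal 1 Rlt_0_1); intros y _ Hy; exact Hy. Qed.

Lemma p_infty_gt (M : R) : Rbar_locally p_infty (fun t => M < t).
Proof. exists M; auto. Qed.

(** The conditions for an improper integral concern whole segments between the two moving endpoints;
    this keeps such segments inside the region where the integrand is smooth. *)
Lemma segments_pos :
  filter_prod (at_right 0) (Rbar_locally p_infty)
    (fun ab : R * R => forall t, Rmin (fst ab) (snd ab) <= t <= Rmax (fst ab) (snd ab) -> 0 < t).
Proof.
  eexists; [apply at_right_0_pos | apply (p_infty_gt 0) |].
  intros a b Ha Hb t [Ht _]; simpl in Ht.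
  apply Rlt_le_trans with (2 := Ht); now apply Rmin_pos.
Qed.

Definition gamma_integrand (x t : R) : R := Rpower t (x - 1) * exp (- t).

Lemma gamma_integrand_pos (x t : R) : 0 < gamma_integrand x t.
Proof. apply Rmult_lt_0_compat; apply exp_pos. Qed.

Lemma gamma_integrand_continuous (x t : R) : 0 < t -> continuous (gamma_integrand x) t.
Proof.
  intros Ht; apply (ex_derive_continuous (gamma_integrand x)).
  unfold gamma_integrand, Rpower; auto_derive; lra.
Qed.

(** Concavity of the logarithm: the right side is the tangent line at [s], raised by 1. *)
Lemma ln_le_line (s t : R) : 0 < s -> 0 < t -> ln t <= t / s + ln s.
Proof.
  intros Hs Ht.
  assert (H := exp_ineq1_le (ln (t / s))).
  rewrite exp_ln in H by (apply Rdiv_lt_0_compat; lra).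
  unfold Rdiv in H at 1; rewrite ln_mult, ln_Rinv in H by (try apply Rinv_0_lt_compat; lra).
  lra.
Qed.

Lemma gamma_integrand_bound (x : R) :
  1 <= x -> exists K, 0 < K /\ forall t, 0 < t -> gamma_integrand x t <= K * exp (- (t / 2)).
Proof.
  intros Hx.
  exists (exp ((x - 1) * ln (2 * x))); split; [apply exp_pos |].
  intros t Ht; unfold gamma_integrand, Rpower; rewrite <- !exp_plus.
  (* Touching at 2x makes the slope of (x-1) ln t at most (x-1)/(2x) < 1/2, so the power costs less
     than half of the decay exp(-t). *)
  assert (H := ln_le_line (2 * x) t ltac:(lra) Ht).
  assert (H1 : (x - 1) * ln t <= (x - 1) * (t / (2 * x) + ln (2 * x)))
    by (apply Rmult_le_compat_l; lra).
  assert (H2 : (x - 1) * (t / (2 * x)) = t / 2 - t / (2 * x)) by (field; lra).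
  assert (H3 : 0 < t / (2 * x)) by (apply Rdiv_lt_0_compat; lra).
  destruct (Rle_lt_or_eq_dec ((x - 1) * ln t + - t) ((x - 1) * ln (2 * x) + - (t / 2)))
    as [H4 | H4]; [lra | left; now apply exp_increasing | right; now rewrite H4].
Qed.

Lemma gamma_integrand_ex_RInt (x a b : R) :
  0 < a -> 0 < b -> ex_RInt (gamma_integrand x) a b.
Proof.
  intros Ha Hb; apply (ex_RInt_continuous (gamma_integrand x)).
  intros z [Hz _]; apply gamma_integrand_continuous.
  apply Rlt_le_trans with (2 := Hz); now apply Rmin_pos.
Qed.

Lemma filterlim_exp_decay_0 (K : R) :
  filterlim (fun t => K * exp (- (t / 2))) (at_right 0) (locally K).
Proof.
  assert (C : continuous (fun t => K * exp (- (t / 2))) 0)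
    by (apply (ex_derive_continuous (fun t => K * exp (- (t / 2)))); auto_derive; auto).
  unfold continuous in C; replace (- (0 / 2)) with 0 in C by field.
  rewrite exp_0, Rmult_1_r in C.
  eapply filterlim_filter_le_1; [apply filter_le_within | exact C].
Qed.

Lemma filterlim_exp_decay_p_infty (K : R) :
  filterlim (fun t => K * exp (- (t / 2))) (Rbar_locally p_infty) (locally 0).
Proof.
  replace 0 with (K * 0) at 1 by ring.
  apply (is_lim_scal_l (fun t => exp (- (t / 2))) K p_infty 0).
  apply (is_lim_comp exp (fun t => - (t / 2)) p_infty 0 m_infty).
  - apply is_lim_exp_m.
  - apply (is_lim_ext (fun t => - / 2 * t)); [intros; field |].
    replace m_infty with (Rbar_mult (- / 2) p_infty); [apply is_lim_scal_l, is_lim_id |].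
    simpl; destruct (Rle_dec 0 (- / 2)) as [H | H]; [exfalso; lra | reflexivity].
  - exists 0; discriminate.
Qed.

Lemma gamma_primitive_derive (x t : R) :
  0 < t -> is_derive (fun s => RInt (gamma_integrand x) 1 s) t (gamma_integrand x t).
Proof.
  intros Ht.
  apply (is_derive_RInt (gamma_integrand x) _ 1 t); [| now apply gamma_integrand_continuous].
  exists (mkposreal t Ht); intros s Hs.
  apply (RInt_correct (gamma_integrand x)), gamma_integrand_ex_RInt; [lra |].
  apply Rabs_def2 in Hs; unfold minus, plus, opp in Hs; simpl in Hs; lra.
Qed.

(** The function -2K exp(-t/2) is a primitive of the dominating integrand, so increments of the two
    primitives compare. It converges both at 0 and at infinity. *)
Lemma gamma_primitive_dominated (x K u v : R) :
  (forall t, 0 < t -> gamma_integrand x t <= K * exp (- (t / 2))) ->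
  0 < u -> 0 < v ->
  Rabs (RInt (gamma_integrand x) 1 v - RInt (gamma_integrand x) 1 u)
  <= Rabs (-2 * K * exp (- (v / 2)) - -2 * K * exp (- (u / 2))).
Proof.
  intros HK.
  assert (W : forall u v, 0 < u -> u <= v ->
    Rabs (RInt (gamma_integrand x) 1 v - RInt (gamma_integrand x) 1 u)
    <= Rabs (-2 * K * exp (- (v / 2)) - -2 * K * exp (- (u / 2)))).
  { clear u v; intros u v Hu Huv.
    assert (E := RInt_Chasles (gamma_integrand x) 1 u v
      (gamma_integrand_ex_RInt x 1 u ltac:(lra) Hu)
      (gamma_integrand_ex_RInt x u v Hu ltac:(lra))).
    unfold plus in E; simpl in E.
    assert (P : 0 <= RInt (gamma_integrand x) u v).
    { apply RInt_ge_0; [lra | apply gamma_integrand_ex_RInt; lra |].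
      intros; left; apply gamma_integrand_pos. }
    assert (I : is_RInt (fun t => K * exp (- (t / 2))) u v
                  (minus (-2 * K * exp (- (v / 2))) (-2 * K * exp (- (u / 2))))).
    { apply (is_RInt_derive (fun t => -2 * K * exp (- (t / 2)))).
      - intros t _; auto_derive; auto; fold (t / 2); field.
      - intros t _; apply (ex_derive_continuous (fun t => K * exp (- (t / 2)))).
        auto_derive; auto. }
    assert (L : RInt (gamma_integrand x) u v
                <= RInt (fun t => K * exp (- (t / 2))) u v).
    { apply RInt_le; [lra | apply gamma_integrand_ex_RInt; lra | eexists; exact I |].
      intros t Ht; apply HK; lra. }
    rewrite (is_RInt_unique _ _ _ _ I) in L.
    unfold minus, plus, opp in L; simpl in L.
    rewrite !Rabs_right; lra. }
  intros Hu Hv; destruct (Rle_dec u v) as [H | H]; [now apply W |].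
  rewrite Rabs_minus_sym, (Rabs_minus_sym (-2 * K * exp (- (v / 2)))).
  apply W; lra.
Qed.

Lemma Gamma_spec (x : R) :
  1 <= x ->
  0 < Gamma x /\
  is_RInt_gen (gamma_integrand x) (at_right 0) (Rbar_locally p_infty) (Gamma x).
Proof.
  intros Hx.
  destruct (gamma_integrand_bound x Hx) as [K [HK HKb]].
  set (F := fun t => RInt (gamma_integrand x) 1 t).
  assert (Hdom : forall u v, 0 < u -> 0 < v ->
    Rabs (F v - F u) <= Rabs (-2 * K * exp (- (v / 2)) - -2 * K * exp (- (u / 2))))
    by (intros; now apply gamma_primitive_dominated).
  destruct (filterlim_dominated (at_right 0) F _ _ _ at_right_0_pos
              (filterlim_exp_decay_0 (-2 * K)) Hdom) as [la Hla].
  destruct (filterlim_dominated (Rbar_locally p_infty) F _ _ _ (p_infty_gt 0)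
              (filterlim_exp_decay_p_infty (-2 * K)) Hdom) as [lb Hlb].
  assert (Hder : forall t, 0 < t -> is_derive F t (gamma_integrand x t))
    by (intros; now apply gamma_primitive_derive).
  assert (Hdom' := segments_pos).
  assert (Hint : is_RInt_gen (gamma_integrand x) (at_right 0) (Rbar_locally p_infty) (lb - la)).
  { apply (is_RInt_gen_ext (Derive F)).
    - eapply filter_imp; [| exact Hdom'].
      intros ab Hab t Ht; apply is_derive_unique, Hder, Hab; lra.
    - apply is_RInt_gen_Derive; try assumption.
      + eapply filter_imp; [| exact Hdom'].
        intros ab Hab t Ht; eexists; now apply Hder, Hab.
      + eapply filter_imp; [| exact Hdom'].
        intros ab Hab t Ht.
        apply (continuous_ext_loc _ (gamma_integrand x)).
        * exists (mkposreal t (Hab t Ht)); intros s Hs.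
          symmetry; apply is_derive_unique, Hder.
          apply Rabs_def2 in Hs; unfold minus, plus, opp in Hs; simpl in Hs; lra.
        * now apply gamma_integrand_continuous, Hab. }
  assert (HG : Gamma x = lb - la) by exact (is_RInt_gen_unique _ _ Hint).
  rewrite HG; split; [| assumption].
  (* Positivity comes from la <= F 1 = 0 < F 2 <= lb, F being increasing. *)
  assert (Hla0 : Rbar_le la (F 1)).
  { refine (filterlim_le (F := at_right 0) F (fun _ => F 1) la (F 1) _ Hla (filterlim_const _)).
    exists (mkposreal 1 Rlt_0_1); intros t Ht Ht0.
    apply Rabs_def2 in Ht; unfold minus, plus, opp in Ht; simpl in Ht.
    unfold F; rewrite RInt_point.
    rewrite <- opp_RInt_swap by (apply gamma_integrand_ex_RInt; lra).
    unfold opp, zero; simpl.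
    enough (0 <= RInt (gamma_integrand x) t 1) by lra.
    apply RInt_ge_0; [lra | apply gamma_integrand_ex_RInt; lra |].
    intros; left; apply gamma_integrand_pos. }
  assert (Hlb0 : Rbar_le (F 2) lb).
  { refine (filterlim_le (F := Rbar_locally p_infty) (fun _ => F 2) F (F 2) lb
              _ (filterlim_const _) Hlb).
    exists 2; intros t Ht.
    assert (E := RInt_Chasles (gamma_integrand x) 1 2 t
      (gamma_integrand_ex_RInt x 1 2 ltac:(lra) ltac:(lra))
      (gamma_integrand_ex_RInt x 2 t ltac:(lra) ltac:(lra))).
    unfold plus in E; simpl in E.
    unfold F; rewrite <- E.
    enough (0 <= RInt (gamma_integrand x) 2 t) by lra.
    apply RInt_ge_0; [lra | apply gamma_integrand_ex_RInt; lra |].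
    intros; left; apply gamma_integrand_pos. }
  simpl in Hla0, Hlb0.
  assert (H2 : 0 < F 2).
  { apply RInt_gt_0; [lra | intros; apply gamma_integrand_pos |].
    intros; apply gamma_integrand_continuous; lra. }
  unfold F in Hla0; rewrite RInt_point in Hla0; unfold zero in Hla0; simpl in Hla0.
  lra.
Qed.

Lemma filterlim_squeeze_0 (F : (R -> Prop) -> Prop) {FF : Filter F} (f g : R -> R) :
  F (fun t => 0 <= f t <= g t) -> filterlim g F (locally 0) -> filterlim f F (locally 0).
Proof.
  intros Hfg Hg.
  apply (filterlim_le_le (fun _ => 0) f g 0 Hfg (filterlim_const _) Hg).
Qed.

(** Integration by parts: f(t) = t^x exp(-t) has derivative x t^(x-1) exp(-t) - t^x exp(-t) and
    tends to 0 at both ends, so the integral of the derivative is 0. *)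
Lemma Gamma_succ (x : R) : 1 <= x -> Gamma (x + 1) = x * Gamma x.
Proof.
  intros Hx.
  destruct (Gamma_spec x Hx) as [_ Ix].
  destruct (Gamma_spec (x + 1) ltac:(lra)) as [_ Ix1].
  set (f := gamma_integrand (x + 1)).
  assert (Hder : forall t, 0 < t ->
     is_derive f t (x * gamma_integrand x t - gamma_integrand (x + 1) t)).
  { intros t Ht; unfold f, gamma_integrand.
    unfold Rpower; auto_derive; [lra |].
    replace (exp ((x - 1) * ln t)) with (exp ((x + 1 - 1) * ln t) * / t).
    - field; lra.
    - rewrite <- (exp_ln t Ht) at 2; rewrite <- exp_Ropp, <- exp_plus; f_equal; ring. }
  assert (Hdom := segments_pos).
  assert (I : is_RInt_gen (Derive f) (at_right 0) (Rbar_locally p_infty) (0 - 0)).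
  { apply is_RInt_gen_Derive.
    - eapply filter_imp; [| exact Hdom].
      intros ab Hab t Ht; eexists; now apply Hder, Hab.
    - eapply filter_imp; [| exact Hdom].
      intros ab Hab t Ht.
      apply (continuous_ext_loc _ (fun t => x * gamma_integrand x t - gamma_integrand (x + 1) t)).
      + exists (mkposreal t (Hab t Ht)); intros s Hs.
        symmetry; apply is_derive_unique, Hder.
        apply Rabs_def2 in Hs; unfold minus, plus, opp in Hs; simpl in Hs; lra.
      + apply (ex_derive_continuous
          (fun t => x * gamma_integrand x t - gamma_integrand (x + 1) t)).
        specialize (Hab t Ht); unfold gamma_integrand, Rpower; auto_derive; lra.
    (* For 0 < t < 1 and x >= 1, t^x exp(-t) is at most t. *)
    - apply (filterlim_squeeze_0 _ f (fun t => t)).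
      + exists (mkposreal 1 Rlt_0_1); intros t Ht Ht0.
        apply Rabs_def2 in Ht; unfold minus, plus, opp in Ht; simpl in Ht.
        split; [left; apply gamma_integrand_pos |].
        unfold f, gamma_integrand, Rpower; rewrite <- exp_plus.
        rewrite <- (exp_ln t Ht0) at 3.
        assert (ln t < 0) by (rewrite <- ln_1; apply ln_increasing; lra).
        left; apply exp_increasing; nra.
      + eapply filterlim_filter_le_1; [apply filter_le_within | apply filterlim_id].
    - destruct (gamma_integrand_bound (x + 1) ltac:(lra)) as [K [HK HKb]].
      apply (filterlim_squeeze_0 _ f (fun t => K * exp (- (t / 2)))).
      + exists 0; intros t Ht; split; [left; apply gamma_integrand_pos | now apply HKb].
      + apply filterlim_exp_decay_p_infty. }
  assert (J : is_RInt_gen (Derive f) (at_right 0) (Rbar_locally p_infty)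
                (minus (scal x (Gamma x)) (Gamma (x + 1)))).
  { apply (is_RInt_gen_ext
      (fun t => minus (scal x (gamma_integrand x t)) (gamma_integrand (x + 1) t))).
    - eapply filter_imp; [| exact Hdom].
      intros ab Hab t Ht; symmetry; apply is_derive_unique, Hder, Hab; lra.
    - exact (is_RInt_gen_minus (fun t => scal x (gamma_integrand x t)) (gamma_integrand (x + 1))
               _ _ (is_RInt_gen_scal (gamma_integrand x) x _ Ix) Ix1). }
  assert (E := eq_trans (eq_sym (is_RInt_gen_unique _ _ I)) (is_RInt_gen_unique _ _ J)).
  unfold minus, plus, opp, scal in E; simpl in E.
  unfold mult in E; simpl in E; lra.
Qed.

Lemma Gamma_1 : Gamma 1 = 1.
Proof.
  unfold Gamma.
  apply is_RInt_gen_unique.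
  set (f := fun t => -1 * exp (- t)).
  assert (Hder : forall t, is_derive f t (exp (- t)))
    by (intros; unfold f; auto_derive; auto; ring).
  apply (is_RInt_gen_ext (Derive f)).
  - apply filter_forall; intros ab t _.
    rewrite (is_derive_unique _ _ _ (Hder t)).
    unfold Rpower; replace ((1 - 1) * ln t) with 0 by ring; rewrite exp_0; simpl; ring.
  - replace 1 with (0 - -1) by ring.
    apply is_RInt_gen_Derive.
    + apply filter_forall; intros ab t _; eexists; apply Hder.
    + apply filter_forall; intros ab t _.
      apply (continuous_ext (fun t => exp (- t))).
      * intros s; symmetry; apply is_derive_unique, Hder.
      * apply (ex_derive_continuous (fun t => exp (- t))); auto_derive; auto.
    + assert (C : continuous f 0) by (apply (ex_derive_continuous f); eexists; apply Hder).
      replace (-1) with (f 0) by (unfold f; rewrite Ropp_0, exp_0; ring).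
      eapply filterlim_filter_le_1; [apply filter_le_within | exact C].
    (* The decay lemma is about exp(-t/2); it is applied at 2t. *)
    + apply (filterlim_ext (fun t => -1 * exp (- (2 * t / 2)))).
      { intros t; unfold f; do 2 f_equal; field. }
      apply (filterlim_comp _ _ _ (fun t => 2 * t) (fun t => -1 * exp (- (t / 2)))
               _ (Rbar_locally p_infty)); [| apply filterlim_exp_decay_p_infty].
      intros P [M HM]; exists (M / 2); intros t Ht; apply HM; lra.
Qed.

(** * Summability in the disk and trigonometric series *)

Definition omega_ratio (nu : R) (n : nat) : R :=
  Gamma (2 - nu) * Gamma (INR n + 1) / Gamma (INR n + 1 - nu).

Lemma omega_ratio_1 (nu : R) : 0 <= nu < 1 -> omega_ratio nu 1 = 1.
Proof.
  intros Hnu; unfold omega_ratio.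
  assert (H : 0 < Gamma (2 - nu)) by (apply Gamma_spec; lra).
  simpl INR.
  rewrite (Gamma_succ 1), Gamma_1 by lra.
  replace (1 + 1 - nu) with (2 - nu) by ring; field; lra.
Qed.

(** By the recursion, passing from n to n+1 multiplies the ratio by (n+1)/(n+1-nu), which lies
    between 1 and (n+1)/n; the upper factors telescope to n. *)
Lemma omega_ratio_bounds (nu : R) (n : nat) :
  0 <= nu < 1 -> (1 <= n)%nat -> 1 <= omega_ratio nu n <= INR n.
Proof.
  intros Hnu Hn; induction Hn as [| n Hn IH].
  - rewrite omega_ratio_1 by assumption; simpl; lra.
  - apply le_INR in Hn; simpl in Hn.
    assert (E : omega_ratio nu (S n) = (INR n + 1) / (INR n + 1 - nu) * omega_ratio nu n).
    { unfold omega_ratio; rewrite S_INR.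
      replace (INR n + 1 + 1 - nu) with (INR n + 1 - nu + 1) by ring.
      rewrite !(Gamma_succ (INR n + 1)), !(Gamma_succ (INR n + 1 - nu)) by lra.
      assert (H : 0 < Gamma (INR n + 1 - nu)) by (apply Gamma_spec; lra).
      field; lra. }
    rewrite E, S_INR.
    assert (H1 : 1 <= (INR n + 1) / (INR n + 1 - nu)).
    { apply (Rmult_le_reg_r (INR n + 1 - nu)); [lra |].
      unfold Rdiv; rewrite Rmult_assoc, Rinv_l by lra; lra. }
    assert (H2 : (INR n + 1) / (INR n + 1 - nu) <= (INR n + 1) / INR n).
    { apply Rmult_le_compat_l; [lra |]; apply Rinv_le_contravar; lra. }
    assert (H3 : (INR n + 1) / INR n * INR n = INR n + 1) by (field; lra).
    split; [nra |].
    eapply Rle_trans; [apply (Rmult_le_compat _ ((INR n + 1) / INR n) _ (INR n)) |]; lra.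
Qed.

Lemma ex_series_nonneg_le (a b : nat -> R) :
  (forall n, 0 <= a n <= b n) -> ex_series b -> ex_series a.
Proof.
  intros Hab; apply (ex_series_le (K := R_AbsRing) (V := R_CompleteNormedModule)).
  intros n; unfold norm; simpl; unfold abs; simpl.
  rewrite Rabs_pos_eq; apply Hab.
Qed.

Lemma ex_series_nonneg_le_eventually (N : nat) (a b : nat -> R) :
  (forall n, (N <= n)%nat -> 0 <= a n <= b n) -> ex_series b -> ex_series a.
Proof.
  intros Hab Hb; apply (ex_series_incr_n a N).
  apply (ex_series_nonneg_le _ (fun k => b (N + k)%nat)).
  - intros n; apply Hab; lia.
  - now apply (ex_series_incr_n b N).
Qed.

Lemma ex_series_scal_R (c : R) (a : nat -> R) :
  ex_series a -> ex_series (fun n => c * a n).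
Proof. apply (ex_series_scal c a). Qed.

Lemma ex_series_plus_R (a b : nat -> R) :
  ex_series a -> ex_series b -> ex_series (fun n => a n + b n).
Proof. apply (ex_series_plus a b). Qed.

Lemma Rabs_Series_le (a b : nat -> R) :
  (forall n, Rabs (a n) <= b n) -> ex_series b -> Rabs (Series a) <= Series b.
Proof.
  intros Hab Hb.
  eapply Rle_trans; [apply Series_Rabs |]; [| apply Series_le]; try assumption.
  - apply (ex_series_nonneg_le _ b); [| assumption].
    intros; split; [apply Rabs_pos | apply Hab].
  - intros; split; [apply Rabs_pos | apply Hab].
Qed.

Definition disk_summable (c : nat -> R) : Prop :=
  forall r, 0 <= r < 1 -> ex_series (fun n => c n * r ^ n).

(** Splits r^n into two equal powers: one bounds a coefficient or a weight, the other still gives a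
    convergent series. *)
Lemma sqrt_in_unit (r : R) : 0 <= r < 1 -> 0 <= sqrt r < 1 /\ r = sqrt r * sqrt r.
Proof.
  intros Hr; repeat split; [apply sqrt_pos | | now rewrite sqrt_sqrt].
  rewrite <- sqrt_1; now apply sqrt_lt_1_alt.
Qed.

Lemma expansion_disk_summable (h : C -> C) (a : nat -> C) :
  has_expansion h a -> disk_summable (fun n => Cmod (a n)).
Proof.
  intros Hh r Hr; destruct (sqrt_in_unit r Hr) as [Hs Hrs]; set (s := sqrt r) in *.
  assert (Hz : disk (RtoC s)) by (unfold disk; rewrite Cmod_R, Rabs_pos_eq; lra).
  assert (Hex : ex_series (K := C_AbsRing) (V := C_CompleteNormedModule)
                  (fun n => (RtoC s ^ n * a n)%C)).
  { exists (h (RtoC s)); eapply is_series_ext; [| exact (Hh _ Hz)].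
    intros n; reflexivity. }
  (* Only one-term Cauchy blocks are used: the terms at radius s are eventually below 1 in modulus,
     leaving the geometric majorant s^n. *)
  destruct (Cauchy_ex_series _ Hex (mkposreal 1 Rlt_0_1)) as [N HN].
  apply (ex_series_nonneg_le_eventually N _ (fun n => s ^ n)).
  - intros n Hn; specialize (HN n n Hn Hn); rewrite sum_n_n in HN.
    change (Cmod (RtoC s ^ n * a n)%C < 1) in HN.
    rewrite Cmod_mult, Cmod_pow, Cmod_R, (Rabs_pos_eq s) in HN by lra.
    rewrite Hrs, Rpow_mult_distr.
    assert (0 <= Cmod (a n)) by apply Cmod_ge_0.
    assert (0 <= s ^ n) by (apply pow_le; lra).
    split; [apply Rmult_le_pos; nra | nra].
  - apply ex_series_geom; rewrite Rabs_pos_eq; lra.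
Qed.

(** The right side is (1-s)(1 + s + ... + s^n), and each of the n+1 powers is at least s^n. Hence
    (n+1) s^n <= 1/(1-s), which absorbs a linear weight. *)
Lemma succ_mult_pow_le (s : R) (n : nat) :
  0 <= s <= 1 -> (INR n + 1) * s ^ n * (1 - s) <= 1 - s ^ (S n).
Proof.
  intros Hs; induction n as [| n IH]; [simpl; lra |].
  rewrite S_INR; simpl in *.
  assert (0 <= s ^ n) by (apply pow_le; lra).
  assert (s ^ n <= 1) by (rewrite <- (pow1 n); apply pow_incr; lra).
  assert (s * ((INR n + 1) * s ^ n * (1 - s)) <= s * (1 - s * s ^ n))
    by (apply Rmult_le_compat_l; [lra | exact IH]).
  assert (s * s ^ n <= 1) by nra.
  assert (s * s ^ n * (1 - s) <= 1 - s) by nra.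
  lra.
Qed.

Lemma disk_summable_weight (c : nat -> R) :
  (forall n, 0 <= c n) -> disk_summable c -> disk_summable (fun n => (INR n + 1) * c n).
Proof.
  intros Hc H r Hr; destruct (sqrt_in_unit r Hr) as [Hs Hrs]; set (s := sqrt r) in *.
  apply (ex_series_nonneg_le _ (fun n => / (1 - s) * (c n * s ^ n)));
    [| now apply ex_series_scal_R, H].
  intros n; rewrite Hrs, Rpow_mult_distr.
  assert (0 <= s ^ n) by (apply pow_le; lra).
  assert (0 <= INR n) by apply pos_INR.
  assert (0 <= c n) by apply Hc.
  assert (B := succ_mult_pow_le s n ltac:(lra)).
  assert (0 <= s ^ S n) by (apply pow_le; lra).
  assert (B' : (INR n + 1) * s ^ n <= / (1 - s)).
  { apply (Rmult_le_reg_r (1 - s)); [lra |]; rewrite Rinv_l; lra. }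
  assert (0 <= c n * s ^ n) by now apply Rmult_le_pos.
  assert (0 <= (INR n + 1) * s ^ n) by (apply Rmult_le_pos; lra).
  replace ((INR n + 1) * c n * (s ^ n * s ^ n))
    with ((INR n + 1) * s ^ n * (c n * s ^ n)) by ring.
  split; [now apply Rmult_le_pos | now apply Rmult_le_compat_r].
Qed.

Lemma disk_summable_pow_weight (p : nat) (c : nat -> R) :
  (forall n, 0 <= c n) -> disk_summable c -> disk_summable (fun n => (INR n + 1) ^ p * c n).
Proof.
  intros Hc H; induction p as [| p IH]; intros r Hr.
  - apply (ex_series_ext (fun n => c n * r ^ n)); [intros; simpl; ring | now apply H].
  - eapply ex_series_ext; [| apply (disk_summable_weight _) in IH; [exact (IH r Hr) |]].
    + intros n; simpl; ring.
    + intros n; apply Rmult_le_pos; [apply pow_le | apply Hc].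
      assert (0 <= INR n) by apply pos_INR; lra.
Qed.

(** A summable quadratic remainder bound replaces uniform convergence of the derivatives: summed and
    divided by h, the error is at most |h| times the sum of [M]. *)
Lemma is_derive_Series (u v : nat -> R -> R) (M : nat -> R) (t : R) :
  (forall s, ex_series (fun n => u n s)) -> ex_series (fun n => v n t) -> ex_series M ->
  (forall n h, Rabs (u n (t + h) - u n t - h * v n t) <= M n * (h * h)) ->
  is_derive (fun s => Series (fun n => u n s)) t (Series (fun n => v n t)).
Proof.
  intros Hu Hv HM Hb; apply is_derive_Reals; intros eps Heps.
  set (S := Series M).
  assert (HS : 0 <= S).
  { assert (B := Rabs_Series_le (fun _ => 0) M).
    eapply Rle_trans; [apply Rabs_pos | apply B]; [| assumption].
    (* The remainder bound at h = 1 forces [M n] to be nonnegative. *)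
    intros n; specialize (Hb n 1); rewrite Rabs_R0.
    assert (P := Rabs_pos (u n (t + 1) - u n t - 1 * v n t)); lra. }
  (* S may be 0, hence the denominator S + 1. *)
  assert (Hd : 0 < eps / (S + 1)) by (apply Rdiv_lt_0_compat; lra).
  exists (mkposreal _ Hd); simpl; intros h Hh Hhd.
  assert (E : Series (fun n => u n (t + h)) - Series (fun n => u n t)
              - h * Series (fun n => v n t)
              = Series (fun n => u n (t + h) - u n t - h * v n t)).
  { rewrite <- Series_scal_l.
    rewrite <- (Series_minus (fun n => u n (t + h)) (fun n => u n t)) by apply Hu.
    rewrite <- Series_minus; [reflexivity | | now apply ex_series_scal_R].
    apply (ex_series_minus (fun n => u n (t + h)) (fun n => u n t)); apply Hu. }
  assert (B : Rabs (Series (fun n => u n (t + h) - u n t - h * v n t)) <= S * (h * h)).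
  { unfold S; rewrite <- Series_scal_r; apply Rabs_Series_le; [intros n; apply Hb |].
    apply (ex_series_ext (fun n => (h * h) * M n)); [intros; simpl; ring |].
    now apply ex_series_scal_R. }
  rewrite <- E in B.
  set (A := Series (fun n => u n (t + h))) in *.
  set (A0 := Series (fun n => u n t)) in *.
  set (D := Series (fun n => v n t)) in *.
  replace ((A - A0) / h - D) with ((A - A0 - h * D) * / h) by (field; assumption).
  rewrite Rabs_mult, Rabs_inv.
  assert (Hah : 0 < Rabs h) by now apply Rabs_pos_lt.
  assert (Hhh : h * h = Rabs h * Rabs h)
    by (rewrite <- Rabs_mult, Rabs_pos_eq; [reflexivity | nra]).
  rewrite Hhh in B.
  apply Rle_lt_trans with (S * Rabs h).
  - apply (Rmult_le_reg_r (Rabs h)); [assumption |].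
    rewrite Rmult_assoc, Rinv_l by lra; lra.
  - apply (Rmult_lt_compat_r (S + 1)) in Hhd; [| lra].
    unfold Rdiv in Hhd; rewrite Rmult_assoc, Rinv_l in Hhd by lra; nra.
Qed.

Lemma Lipschitz_of_derive (f df : R -> R) (K : R) :
  (forall x, is_derive f x (df x)) -> (forall x, Rabs (df x) <= K) ->
  forall x y, Rabs (f y - f x) <= K * Rabs (y - x).
Proof.
  intros Hf HK x y.
  destruct (MVT_gen f x y df) as [c [_ ->]].
  - intros; apply Hf.
  - intros z _; apply continuity_pt_filterlim, (ex_derive_continuous f); eexists; apply Hf.
  - rewrite Rabs_mult; apply Rmult_le_compat_r; [apply Rabs_pos | apply HK].
Qed.

(** The mean value theorem turns the remainder into h (df c - df t) with |c - t| <= |h|, and [df] is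
    K-Lipschitz. The sharper constant K/2 is not sought. *)
Lemma Taylor_remainder_2 (f df ddf : R -> R) (K : R) :
  (forall x, is_derive f x (df x)) -> (forall x, is_derive df x (ddf x)) ->
  (forall x, Rabs (ddf x) <= K) ->
  forall t h, Rabs (f (t + h) - f t - h * df t) <= K * (h * h).
Proof.
  intros Hf Hdf HK t h.
  destruct (MVT_gen f t (t + h) df) as [c [Hc E]].
  - intros; apply Hf.
  - intros z _; apply continuity_pt_filterlim, (ex_derive_continuous f); eexists; apply Hf.
  - rewrite E; replace (df c * (t + h - t) - h * df t) with (h * (df c - df t)) by ring.
    assert (L := Lipschitz_of_derive df ddf K Hdf HK t c).
    assert (K0 : 0 <= K) by (eapply Rle_trans; [apply Rabs_pos | apply (HK 0)]).
    assert (Hch : Rabs (c - t) <= Rabs h).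
    { revert Hc; unfold Rmin, Rmax, Rabs.
      destruct (Rle_dec t (t + h)), (Rcase_abs (c - t)), (Rcase_abs h); lra. }
    rewrite Rabs_mult.
    assert (Hhh : h * h = Rabs h * Rabs h)
      by (rewrite <- Rabs_mult, Rabs_pos_eq; [reflexivity | nra]).
    rewrite Hhh.
    assert (0 <= Rabs h) by apply Rabs_pos.
    assert (0 <= Rabs (c - t)) by apply Rabs_pos.
    assert (Rabs (df c - df t) <= K * Rabs h) by nra.
    nra.
Qed.

Definition rapidly_decreasing (c : nat -> R) : Prop :=
  forall p, ex_series (fun n => (INR n + 1) ^ p * Rabs (c n)).

Definition trig_term (al be : nat -> R) (n : nat) (t : R) : R :=
  al n * cos (INR n * t) + be n * sin (INR n * t).

Definition trig_series (al be : nat -> R) (t : R) : R :=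
  Series (fun n => trig_term al be n t).

Lemma rapidly_decreasing_weight (e : R) (c : nat -> R) :
  rapidly_decreasing c -> rapidly_decreasing (fun n => e * INR n * c n).
Proof.
  intros H p.
  apply (ex_series_nonneg_le _ (fun n => Rabs e * ((INR n + 1) ^ S p * Rabs (c n))));
    [| apply ex_series_scal_R, H].
  intros n.
  assert (0 <= INR n) by apply pos_INR.
  assert (0 <= Rabs e) by apply Rabs_pos.
  assert (0 <= Rabs (c n)) by apply Rabs_pos.
  assert (0 <= (INR n + 1) ^ p) by (apply pow_le; lra).
  assert (0 <= (INR n + 1) ^ p * Rabs (c n)) by now apply Rmult_le_pos.
  rewrite !Rabs_mult, (Rabs_pos_eq (INR n)) by assumption.
  simpl; split; [repeat apply Rmult_le_pos; assumption |].
  replace ((INR n + 1) ^ p * (Rabs e * INR n * Rabs (c n)))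
    with (Rabs e * (INR n * ((INR n + 1) ^ p * Rabs (c n)))) by ring.
  apply Rmult_le_compat_l; [assumption | nra].
Qed.

Lemma trig_bound (A B x : R) : Rabs (A * cos x + B * sin x) <= Rabs A + Rabs B.
Proof.
  eapply Rle_trans; [apply Rabs_triang |]; rewrite !Rabs_mult.
  assert (Rabs (cos x) <= 1) by (apply Rabs_le, COS_bound).
  assert (Rabs (sin x) <= 1) by (apply Rabs_le, SIN_bound).
  assert (0 <= Rabs A) by apply Rabs_pos.
  assert (0 <= Rabs B) by apply Rabs_pos.
  nra.
Qed.

Lemma trig_series_ex (al be : nat -> R) (t : R) :
  rapidly_decreasing al -> rapidly_decreasing be ->
  ex_series (fun n => trig_term al be n t).
Proof.
  intros Ha Hb.
  apply (ex_series_le (K := R_AbsRing) (V := R_CompleteNormedModule) _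
           (fun n => Rabs (al n) + Rabs (be n))).
  - intros n; apply trig_bound.
  - apply ex_series_plus_R; [specialize (Ha O) | specialize (Hb O)];
      (eapply ex_series_ext; [| eassumption]); intros; simpl; ring.
Qed.

(** The factors 1 and -1 are kept so that the new coefficients have the shape of
    [rapidly_decreasing_weight] and the lemma can be iterated. Second derivatives carry n^2, whence
    the majorant with (n+1)^2. *)
Lemma is_derive_trig_series (al be : nat -> R) (t : R) :
  rapidly_decreasing al -> rapidly_decreasing be ->
  is_derive (trig_series al be) t
    (trig_series (fun n => 1 * INR n * be n) (fun n => -1 * INR n * al n) t).
Proof.
  intros Ha Hb.
  apply (is_derive_Series (trig_term al be)
    (trig_term (fun n => 1 * INR n * be n) (fun n => -1 * INR n * al n))
    (fun n => (INR n + 1) ^ 2 * Rabs (al n) + (INR n + 1) ^ 2 * Rabs (be n))).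
  - intros s; now apply trig_series_ex.
  - apply trig_series_ex; now apply rapidly_decreasing_weight.
  - apply ex_series_plus_R; [apply Ha | apply Hb].
  - intros n h.
    apply (Taylor_remainder_2 _ _
      (fun s => INR n * INR n * (- al n) * cos (INR n * s)
                + INR n * INR n * (- be n) * sin (INR n * s))).
    + intros x; unfold trig_term; auto_derive; auto; ring.
    + intros x; unfold trig_term; auto_derive; auto; ring.
    + intros x; eapply Rle_trans; [apply trig_bound |].
      assert (0 <= INR n) by apply pos_INR.
      rewrite !Rabs_mult, !Rabs_Ropp, (Rabs_pos_eq (INR n)) by assumption.
      assert (0 <= Rabs (al n)) by apply Rabs_pos.
      assert (0 <= Rabs (be n)) by apply Rabs_pos.
      apply Rplus_le_compat; (apply Rmult_le_compat_r; [assumption | nra]).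
Qed.

(** * The operator on a circle *)

Lemma polar_pow (r t : R) (n : nat) : (polar r t ^ n)%C = polar (r ^ n) (INR n * t).
Proof.
  induction n as [| n IH].
  - unfold polar; simpl; rewrite Rmult_0_l, cos_0, sin_0, Rmult_0_r, Rmult_1_r; reflexivity.
  - rewrite S_INR; replace ((INR n + 1) * t) with (t + INR n * t) by ring.
    change (polar r t * polar r t ^ n = polar (r ^ S n) (t + INR n * t))%C.
    rewrite IH; unfold polar, Cmult; simpl; rewrite cos_plus, sin_plus.
    f_equal; ring.
Qed.

Lemma Re_Cdiv (u v x y : R) :
  Re ((u, v) / (x, y))%C = (u * x + v * y) / (x * x + y * y).
Proof.
  unfold Cdiv, Cinv, Cmult, Re; simpl; unfold Rdiv; rewrite !Rmult_1_r; ring.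
Qed.

Lemma Re_RtoC_mult (c : R) (z : C) : Re (RtoC c * z)%C = c * Re z.
Proof. unfold Cmult, Re; simpl; ring. Qed.

Lemma Re_Cplus (z w : C) : Re (z + w)%C = Re z + Re w.
Proof. reflexivity. Qed.

Lemma im_le_Cmod (z : C) : Rabs (Im z) <= Cmod z.
Proof. eapply Rle_trans; [apply Rmax_r | apply (Rmax_Cmod z)]. Qed.

Lemma polar_norm2 (r t : R) : r * cos t * (r * cos t) + r * sin t * (r * sin t) = r * r.
Proof.
  assert (H := sin2_cos2 t); unfold Rsqr in H.
  replace (r * r) with (r * r * (sin t * sin t + cos t * cos t)) by (rewrite H; ring); ring.
Qed.

Lemma rapidly_decreasing_disk (c al : nat -> R) (r : R) :
  0 <= r < 1 -> disk_summable c -> (forall n, Rabs (al n) <= c n * r ^ n) ->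
  rapidly_decreasing al.
Proof.
  intros Hr Hc Hal p.
  destruct (Rle_lt_or_eq_dec 0 r (proj1 Hr)) as [Hr0 | <-].
  - assert (Hc0 : forall n, 0 <= c n).
    { intros n; apply (Rmult_le_reg_r (r ^ n)); [now apply pow_lt |].
      rewrite Rmult_0_l; eapply Rle_trans; [apply Rabs_pos | apply Hal]. }
    apply (ex_series_nonneg_le _ (fun n => (INR n + 1) ^ p * c n * r ^ n));
      [| now apply disk_summable_pow_weight].
    intros n.
    assert (0 <= (INR n + 1) ^ p) by (apply pow_le; assert (P := pos_INR n); lra).
    split; [apply Rmult_le_pos; [assumption | apply Rabs_pos] |].
    rewrite Rmult_assoc; now apply Rmult_le_compat_l.
  (* At r = 0 the bound says nothing about the sign of [c], but it kills every coefficient of index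
     at least 1, so any convergent majorant will do. *)
  - apply (ex_series_nonneg_le_eventually 1 _ (fun n => (1 / 2) ^ n)).
    + intros n Hn.
      assert (E : Rabs (al n) = 0).
      { apply Rle_antisym; [| apply Rabs_pos].
        eapply Rle_trans; [apply Hal |]; rewrite pow_i by lia; lra. }
      rewrite E, Rmult_0_r; split; [lra | apply pow_le; lra].
    + apply ex_series_geom; rewrite Rabs_pos_eq; lra.
Qed.

Lemma disk_summable_plus (c d : nat -> R) :
  disk_summable c -> disk_summable d -> disk_summable (fun n => c n + d n).
Proof.
  intros Hc Hd r Hr.
  apply (ex_series_ext (fun n => c n * r ^ n + d n * r ^ n)); [intros; simpl; ring |].
  apply ex_series_plus_R; [now apply Hc | now apply Hd].
Qed.

Lemma Omega_coef_eq (nu : R) (c : nat -> C) (n : nat) :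
  Omega_coef nu c n = (RtoC (omega_ratio nu n) * c n)%C.
Proof. reflexivity. Qed.

Lemma Omega_disk_summable (nu : R) (c : nat -> C) :
  0 <= nu < 1 -> c O = RtoC 0 -> disk_summable (fun n => Cmod (c n)) ->
  disk_summable (fun n => Cmod (Omega_coef nu c n)).
Proof.
  intros Hnu Hc0 Hc r Hr.
  (* Starting at 1 avoids Gamma(1-nu), whose argument is below 1 when nu > 0. *)
  apply (ex_series_nonneg_le_eventually 1 _ (fun n => (INR n + 1) * Cmod (c n) * r ^ n)).
  - intros n Hn.
    destruct (omega_ratio_bounds nu n Hnu Hn) as [H1 H2].
    rewrite Omega_coef_eq, Cmod_mult, Cmod_R, Rabs_pos_eq by lra.
    assert (0 <= Cmod (c n)) by apply Cmod_ge_0.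
    assert (0 <= r ^ n) by (apply pow_le; lra).
    split; [apply Rmult_le_pos; [apply Rmult_le_pos |]; lra |].
    apply Rmult_le_compat_r; [assumption |]; apply Rmult_le_compat_r; lra.
  - apply (disk_summable_weight (fun n => Cmod (c n))); [| assumption | assumption].
    intros; apply Cmod_ge_0.
Qed.

(** These four sequences are the Fourier coefficients, on the circle of radius [r], of the real and
    imaginary parts of sum A_n z^n + conj (sum B_n z^n). *)
Definition re_cos (r : R) (A B : nat -> C) (n : nat) : R := r ^ n * (Re (A n) + Re (B n)).
Definition re_sin (r : R) (A B : nat -> C) (n : nat) : R := - (r ^ n * (Im (A n) + Im (B n))).
Definition im_cos (r : R) (A B : nat -> C) (n : nat) : R := r ^ n * (Im (A n) - Im (B n)).
Definition im_sin (r : R) (A B : nat -> C) (n : nat) : R := r ^ n * (Re (A n) - Re (B n)).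

Lemma boundary_coef_rapid (r : R) (A B : nat -> C) :
  0 <= r < 1 ->
  disk_summable (fun n => Cmod (A n)) -> disk_summable (fun n => Cmod (B n)) ->
  rapidly_decreasing (re_cos r A B) /\ rapidly_decreasing (re_sin r A B) /\
  rapidly_decreasing (im_cos r A B) /\ rapidly_decreasing (im_sin r A B).
Proof.
  intros Hr HA HB.
  assert (HAB := disk_summable_plus _ _ HA HB).
  assert (K : forall n x y, Rabs x <= Cmod (A n) -> Rabs y <= Cmod (B n) ->
    Rabs (r ^ n * (x + y)) <= (Cmod (A n) + Cmod (B n)) * r ^ n).
  { intros n x y Hx Hy.
    assert (0 <= r ^ n) by (apply pow_le; lra).
    rewrite Rabs_mult, (Rabs_pos_eq (r ^ n)), Rmult_comm by assumption.
    apply Rmult_le_compat_r; [assumption |].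
    eapply Rle_trans; [apply Rabs_triang | lra]. }
  repeat split; apply (rapidly_decreasing_disk _ _ r Hr HAB); intros n;
    unfold re_cos, re_sin, im_cos, im_sin, Rminus; rewrite ?Rabs_Ropp;
    apply K; rewrite ?Rabs_Ropp; auto using re_le_Cmod, im_le_Cmod.
Qed.

Lemma CSeries_polar_eq (r : R) (A B : nat -> C) (t : R) :
  0 <= r < 1 ->
  disk_summable (fun n => Cmod (A n)) -> disk_summable (fun n => Cmod (B n)) ->
  (CPSeries A (polar r t) + Cconj (CPSeries B (polar r t)))%C
  = (trig_series (re_cos r A B) (re_sin r A B) t, trig_series (im_cos r A B) (im_sin r A B) t).
Proof.
  intros Hr HA HB.
  assert (HC : forall (D : nat -> C), disk_summable (fun n => Cmod (D n)) ->
     ex_series (fun n => Re (D n * polar r t ^ n)%C) /\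
     ex_series (fun n => Im (D n * polar r t ^ n)%C)).
  { intros D HD.
    assert (N : forall n, Cmod (D n * polar r t ^ n)%C = Cmod (D n) * r ^ n).
    { intros n; rewrite Cmod_mult, Cmod_pow; do 2 f_equal.
      unfold Cmod, polar; simpl; rewrite !Rmult_1_r, polar_norm2; apply sqrt_square; lra. }
    split; apply (ex_series_le (K := R_AbsRing) (V := R_CompleteNormedModule) _
             (fun n => Cmod (D n) * r ^ n)); try (now apply HD); intros n; rewrite <- N.
    - apply re_le_Cmod.
    - apply im_le_Cmod. }
  destruct (HC A HA) as [A1 A2], (HC B HB) as [B1 B2].
  unfold CPSeries, CSeries, Cconj, Cplus, trig_series, trig_term; simpl; f_equal.
  - rewrite <- Series_plus by assumption; apply Series_ext; intros n.
    rewrite polar_pow; unfold re_cos, re_sin, polar, Re, Im; simpl; ring.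
  - rewrite <- Series_opp, <- Series_plus; [| assumption | now apply (ex_series_opp (V := R_NormedModule))].
    apply Series_ext; intros n.
    rewrite polar_pow; unfold im_cos, im_sin, polar, Re, Im; simpl; ring.
Qed.

Lemma CDerive_pair (F : R -> C) (u v u' v' : R -> R) (t : R) :
  (forall s, F s = (u s, v s)) -> is_derive u t (u' t) -> is_derive v t (v' t) ->
  CDerive F t = (u' t, v' t).
Proof.
  intros HF Hu Hv; unfold CDerive.
  rewrite (Derive_ext _ u), (Derive_ext (fun s => Im (F s)) v)
    by (intros; now rewrite HF).
  now rewrite (is_derive_unique _ _ _ Hu), (is_derive_unique _ _ _ Hv).
Qed.

(** P_n and Q_n of the overview. On z^n the three quotients give z^(n-1) times 1, n, n^2, and on
    conj z^n they give conj z^n / z times 1, -n, n^2; combining them with weights 1-lambda,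
    lambda(1-k), lambda k and factoring yields P_n and Q_n. *)
Definition phi_factor (lambda k : R) (n : nat) : R :=
  1 + lambda * (INR n - 1) * (1 + INR n * k).

Definition psi_factor (lambda k : R) (n : nat) : R :=
  1 - lambda * (INR n + 1) * (1 - INR n * k).

(** Dividing by z lowers the angle nt to (n-1)t, while conj (b_n z^n) / z is conj (b_n e^(i(n+1)t))
    times r^(n-1). Writing r^n / r avoids a truncated exponent at n = 0. *)
Definition hm_term (lambda k nu : R) (a b : nat -> C) (r t : R) (n : nat) : R :=
  r ^ n / r *
  (phi_factor lambda k n
     * (Re (Omega_coef nu a n) * cos ((INR n - 1) * t)
        - Im (Omega_coef nu a n) * sin ((INR n - 1) * t))
   + psi_factor lambda k n
     * (Re (Omega_coef nu b n) * cos ((INR n + 1) * t)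
        - Im (Omega_coef nu b n) * sin ((INR n + 1) * t))).

Lemma is_series_lin2 (p q U V : R) (u v : nat -> R) :
  is_series u U -> is_series v V -> is_series (fun n => p * u n + q * v n) (p * U + q * V).
Proof.
  intros Hu Hv.
  apply (is_series_plus (fun n => p * u n) (fun n => q * v n) (p * U) (q * V)).
  - exact (is_series_scal p u U Hu).
  - exact (is_series_scal q v V Hv).
Qed.

Lemma HM_re_is_series (lambda k nu : R) (a b : nat -> C) (r t : R) :
  0 <= nu < 1 -> 0 < r < 1 -> a O = RtoC 0 -> b O = RtoC 0 ->
  disk_summable (fun n => Cmod (a n)) -> disk_summable (fun n => Cmod (b n)) ->
  is_series (hm_term lambda k nu a b r t) (HM_re lambda k nu a b r t).
Proof.
  intros Hnu Hr Ha0 Hb0 Ha Hb.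
  assert (HA := Omega_disk_summable nu a Hnu Ha0 Ha).
  assert (HB := Omega_disk_summable nu b Hnu Hb0 Hb).
  assert (Hr' : 0 <= r < 1) by lra.
  assert (HW := fun t => CSeries_polar_eq r _ _ t Hr' HA HB).
  destruct (boundary_coef_rapid r _ _ Hr' HA HB) as (R1 & R2 & R3 & R4).
  set (A := Omega_coef nu a) in *; set (B := Omega_coef nu b) in *.
  set (c1 := re_cos r A B) in *.
  set (s1 := re_sin r A B) in *.
  set (c2 := im_cos r A B) in *.
  set (s2 := im_sin r A B) in *.
  set (d := fun (e : R) (c : nat -> R) (n : nat) => e * INR n * c n).
  assert (HD1 : forall s, CDerive (fun t => Omega nu a b (polar r t)) s
     = (trig_series (d 1 s1) (d (-1) c1) s, trig_series (d 1 s2) (d (-1) c2) s)).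
  { intros s; apply (CDerive_pair _ _ _ (trig_series (d 1 s1) (d (-1) c1))
                       (trig_series (d 1 s2) (d (-1) c2)) s HW);
      now apply is_derive_trig_series. }
  assert (HD2 : forall s, CDerive (CDerive (fun t => Omega nu a b (polar r t))) s
     = (trig_series (d 1 (d (-1) c1)) (d (-1) (d 1 s1)) s,
        trig_series (d 1 (d (-1) c2)) (d (-1) (d 1 s2)) s)).
  { intros s; apply (CDerive_pair _ _ _ (trig_series (d 1 (d (-1) c1)) (d (-1) (d 1 s1)))
                       (trig_series (d 1 (d (-1) c2)) (d (-1) (d 1 s2))) s HD1);
      apply is_derive_trig_series; now apply rapidly_decreasing_weight. }
  assert (HZ1 : forall s, CDerive (polar r) s = (r * - sin s, r * cos s)).
  { intros s; apply (CDerive_pair _ (fun s => r * cos s) (fun s => r * sin s)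
                       (fun s => r * - sin s) (fun s => r * cos s));
      [reflexivity | |]; auto_derive; auto; ring. }
  assert (HZ2 : CDerive (CDerive (polar r)) t = (r * - cos t, r * - sin t)).
  { apply (CDerive_pair _ (fun s => r * - sin s) (fun s => r * cos s)
             (fun s => r * - cos s) (fun s => r * - sin s));
      [exact HZ1 | |]; auto_derive; auto; ring. }
  unfold HM_re; cbv zeta.
  change (fun t0 : R => Omega nu a b (polar r t0))
    with (fun t => Omega nu a b (polar r t)).
  rewrite !Re_Cplus, !Re_RtoC_mult, HD1, HD2, HZ1, HZ2.
  unfold Omega at 1; fold A; fold B; rewrite HW.
  change (polar r t) with (r * cos t, r * sin t).
  rewrite !Re_Cdiv.
  rewrite polar_norm2.
  replace (r * - sin t * (r * - sin t) + r * cos t * (r * cos t)) with (r * r)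
    by (rewrite <- (polar_norm2 r t); ring).
  replace (r * - cos t * (r * - cos t) + r * - sin t * (r * - sin t)) with (r * r)
    by (rewrite <- (polar_norm2 r t); ring).
  assert (S1 := Series_correct _ (trig_series_ex c1 s1 t R1 R2)).
  assert (S2 := Series_correct _ (trig_series_ex c2 s2 t R3 R4)).
  assert (S3 := Series_correct _ (trig_series_ex (d 1 s1) (d (-1) c1) t
    (rapidly_decreasing_weight _ _ R2) (rapidly_decreasing_weight _ _ R1))).
  assert (S4 := Series_correct _ (trig_series_ex (d 1 s2) (d (-1) c2) t
    (rapidly_decreasing_weight _ _ R4) (rapidly_decreasing_weight _ _ R3))).
  assert (S5 := Series_correct _ (trig_series_ex (d 1 (d (-1) c1)) (d (-1) (d 1 s1)) t
    (rapidly_decreasing_weight _ _ (rapidly_decreasing_weight _ _ R1))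
    (rapidly_decreasing_weight _ _ (rapidly_decreasing_weight _ _ R2)))).
  assert (S6 := Series_correct _ (trig_series_ex (d 1 (d (-1) c2)) (d (-1) (d 1 s2)) t
    (rapidly_decreasing_weight _ _ (rapidly_decreasing_weight _ _ R3))
    (rapidly_decreasing_weight _ _ (rapidly_decreasing_weight _ _ R4)))).
  fold (trig_series c1 s1 t) in S1; fold (trig_series c2 s2 t) in S2.
  fold (trig_series (d 1 s1) (d (-1) c1) t) in S3.
  fold (trig_series (d 1 s2) (d (-1) c2) t) in S4.
  fold (trig_series (d 1 (d (-1) c1)) (d (-1) (d 1 s1)) t) in S5.
  fold (trig_series (d 1 (d (-1) c2)) (d (-1) (d 1 s2)) t) in S6.
  (* By [Re_Cdiv], dividing by z, z' or z'' pairs the two components with (cos t, sin t)/r, (-sin t,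
     cos t)/r or (-cos t, -sin t)/r; these are the coefficients used here. *)
  assert (T := is_series_lin2 1 1 _ _ _ _
    (is_series_lin2 ((1 - lambda) * cos t / r) ((1 - lambda) * sin t / r) _ _ _ _ S1 S2)
    (is_series_lin2 1 1 _ _ _ _
      (is_series_lin2 (lambda * (1 - k) * - sin t / r) (lambda * (1 - k) * cos t / r)
         _ _ _ _ S3 S4)
      (is_series_lin2 (lambda * k * - cos t / r) (lambda * k * - sin t / r) _ _ _ _ S5 S6))).
  match type of T with is_series _ ?l => match goal with |- is_series _ ?l' =>
    replace l' with l by (field; lra) end end.
  eapply is_series_ext; [| exact T].
  intros n; unfold hm_term, trig_term, d, c1, s1, c2, s2, re_cos, re_sin, im_cos, im_sin, phi_factor, psi_factor; fold A; fold B.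
  replace ((INR n - 1) * t) with (INR n * t - t) by ring.
  replace ((INR n + 1) * t) with (INR n * t + t) by ring.
  rewrite cos_plus, sin_plus, cos_minus, sin_minus.
  match goal with |- ?x = ?y => change (x = y :> R) end.
  field; lra.
Qed.

(** * The coefficient bound *)

Lemma phi_eq (n : nat) (k lambda nu : R) :
  phi n k lambda nu = phi_factor lambda k n * omega_ratio nu n.
Proof. unfold phi, phi_factor, omega_ratio, Rdiv; ring. Qed.

Lemma psi_eq (n : nat) (k lambda nu : R) :
  psi n k lambda nu = psi_factor lambda k n * omega_ratio nu n.
Proof. unfold psi, psi_factor, omega_ratio, Rdiv; ring. Qed.

Lemma phi_factor_ge_1 (lambda k : R) (n : nat) :
  0 <= lambda -> 0 <= k -> (1 <= n)%nat -> 1 <= phi_factor lambda k n.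
Proof.
  intros Hl Hk Hn; apply le_INR in Hn; simpl in Hn; unfold phi_factor.
  assert (0 <= INR n * k) by (apply Rmult_le_pos; lra).
  assert (0 <= lambda * (INR n - 1)) by (apply Rmult_le_pos; lra).
  nra.
Qed.

(** The left side is |Re (z e^(ix))|, and a rotation keeps the modulus. *)
Lemma Rabs_Re_rotation_le (z : C) (x : R) : Rabs (Re z * cos x - Im z * sin x) <= Cmod z.
Proof.
  replace (Re z * cos x - Im z * sin x) with (Re (z * (cos x, sin x))%C) by reflexivity.
  eapply Rle_trans; [apply re_le_Cmod |].
  rewrite Cmod_mult; apply Req_le.
  replace (Cmod (cos x, sin x)) with 1; [ring |].
  unfold Cmod; simpl.
  replace (cos x * (cos x * 1) + sin x * (sin x * 1)) with ((sin x)² + (cos x)²)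
    by (unfold Rsqr; ring).
  now rewrite sin2_cos2, sqrt_1.
Qed.

Lemma hm_term_bound (lambda k nu : R) (a b : nat -> C) (r t : R) (n : nat) :
  0 <= nu < 1 -> 0 <= lambda -> 0 <= k -> 0 < r < 1 ->
  Rabs (hm_term lambda k nu a b r t (S n))
  <= phi (S n) k lambda nu * Cmod (a (S n)) + Rabs (psi (S n) k lambda nu) * Cmod (b (S n)).
Proof.
  intros Hnu Hl Hk Hr.
  destruct (omega_ratio_bounds nu (S n) Hnu ltac:(lia)) as [Hc _].
  assert (Hphi := phi_factor_ge_1 lambda k (S n) Hl Hk ltac:(lia)).
  unfold hm_term; rewrite phi_eq, psi_eq, !Omega_coef_eq.
  set (m := S n) in *.
  replace (r ^ m / r) with (r ^ n) by (unfold m; simpl; field; lra).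
  assert (Hrn : 0 <= r ^ n) by (apply pow_le; lra).
  assert (Hrn1 : r ^ n <= 1) by (rewrite <- (pow1 n); apply pow_incr; lra).
  set (za := (RtoC (omega_ratio nu m) * a m)%C).
  set (zb := (RtoC (omega_ratio nu m) * b m)%C).
  assert (Ea : Cmod za = omega_ratio nu m * Cmod (a m))
    by (unfold za; rewrite Cmod_mult, Cmod_R, Rabs_pos_eq; [reflexivity | lra]).
  assert (Eb : Cmod zb = omega_ratio nu m * Cmod (b m))
    by (unfold zb; rewrite Cmod_mult, Cmod_R, Rabs_pos_eq; [reflexivity | lra]).
  assert (Ba := Rabs_Re_rotation_le za ((INR m - 1) * t)).
  assert (Bb := Rabs_Re_rotation_le zb ((INR m + 1) * t)).
  rewrite (Rabs_mult (psi_factor lambda k m)), (Rabs_pos_eq (omega_ratio nu m)) by lra.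
  rewrite !Rmult_assoc, <- Ea, <- Eb.
  set (X := Re za * _ - _) in *; set (Y := Re zb * _ - _) in *.
  rewrite Rabs_mult, (Rabs_pos_eq (r ^ n)) by assumption.
  apply Rle_trans with (Rabs (phi_factor lambda k m * X + psi_factor lambda k m * Y)).
  - rewrite <- (Rmult_1_l (Rabs (_ + _))) at 2.
    apply Rmult_le_compat_r; [apply Rabs_pos | assumption].
  - eapply Rle_trans; [apply Rabs_triang |]; rewrite !Rabs_mult.
    rewrite (Rabs_pos_eq (phi_factor lambda k m)) by lra.
    apply Rplus_le_compat; apply Rmult_le_compat_l; try assumption; [lra | apply Rabs_pos].
Qed.

Lemma HM_re_lower_bound (lambda k nu : R) (a b : nat -> C) (r t : R) :
  0 <= nu < 1 -> 0 <= lambda -> 0 <= k -> 0 < r < 1 ->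
  a O = RtoC 0 -> a 1%nat = RtoC 1 -> b O = RtoC 0 ->
  disk_summable (fun n => Cmod (a n)) -> disk_summable (fun n => Cmod (b n)) ->
  ex_series (phi_term k lambda nu a) -> ex_series (psi_term k lambda nu b) ->
  1 - (Series (phi_term k lambda nu a) + Series (psi_term k lambda nu b))
  <= HM_re lambda k nu a b r t.
Proof.
  intros Hnu Hl Hk Hr Ha0 Ha1 Hb0 Ha Hb Hphi Hpsi.
  assert (HS := HM_re_is_series lambda k nu a b r t Hnu Hr Ha0 Hb0 Ha Hb).
  set (T := hm_term lambda k nu a b r t) in *.
  assert (Hex : ex_series T) by (eexists; exact HS).
  apply is_series_unique in HS; rewrite <- HS.
  rewrite (Series_incr_1 T Hex), (Series_incr_1 (fun n => T (S n)))
    by (now apply (ex_series_incr_n T 1)).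
  (* [phi_term] starts at coefficient 2 and [psi_term] at coefficient 1. Splitting off b_1, which is
     handled together with the main term a_1 = 1, aligns the two tails. *)
  rewrite (Series_incr_1 (psi_term k lambda nu b) Hpsi).
  assert (T0 : T O = 0).
  { unfold T, hm_term; rewrite !Omega_coef_eq, Ha0, Hb0; unfold Cmult, Re, Im; simpl; ring. }
  assert (T1 : 1 - psi_term k lambda nu b 0 <= T 1%nat).
  { unfold T, hm_term, psi_term; rewrite psi_eq, !Omega_coef_eq, Ha1.
    change (0 + 1)%nat with 1%nat; rewrite omega_ratio_1, !Cmult_1_l by assumption.
    replace (phi_factor lambda k 1) with 1 by (unfold phi_factor; simpl; ring).
    replace ((INR 1 - 1) * t) with 0 by (simpl; ring).
    rewrite sin_0, cos_0.
    replace (r ^ 1 / r) with 1 by (field; lra).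
    assert (B := Rabs_Re_rotation_le (b 1%nat) ((INR 1 + 1) * t)).
    set (Y := Re (b 1%nat) * _ - _) in *.
    rewrite Rmult_1_r.
    assert (Rabs (psi_factor lambda k 1 * Y) <= Rabs (psi_factor lambda k 1) * Cmod (b 1%nat))
      by (rewrite Rabs_mult; apply Rmult_le_compat_l; [apply Rabs_pos | assumption]).
    assert (L := Rle_abs (- (psi_factor lambda k 1 * Y))); rewrite Rabs_Ropp in L.
    simpl; lra. }
  assert (B : Rabs (Series (fun n => T (S (S n))))
              <= Series (phi_term k lambda nu a)
                 + Series (fun n => psi_term k lambda nu b (S n))).
  { assert (Hpsi' : ex_series (fun n => psi_term k lambda nu b (S n)))
      by (now apply (ex_series_incr_n (psi_term k lambda nu b) 1)).
    rewrite <- Series_plus by assumption.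
    apply Rabs_Series_le; [| now apply ex_series_plus_R].
    intros n; unfold phi_term, psi_term.
    replace (n + 2)%nat with (S (S n)) by lia.
    replace (S n + 1)%nat with (S (S n)) by lia.
    now apply hm_term_bound. }
  assert (L := Rle_abs (- Series (fun n => T (S (S n))))); rewrite Rabs_Ropp in L.
  lra.
Qed.

(** * Complex series and the coefficients of the extremal functions *)

Lemma is_series_CSeries (u : nat -> C) :
  ex_series (fun n => Cmod (u n)) ->
  is_series (K := C_AbsRing) (V := C_NormedModule) u (CSeries u).
Proof.
  intros Hu.
  destruct (ex_series_le (K := C_AbsRing) (V := C_CompleteNormedModule) u (fun n => Cmod (u n)))
    as [l Hl]; [intros n; apply Rle_refl | assumption |].
  replace (CSeries u) with l; [exact Hl |].
  (* Completeness gives some complex sum l. An additive functional bounded by the modulus commutes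
     with the limit; for Re and Im this identifies l with the componentwise sum. *)
  assert (Hs : forall (P : C -> R), (forall z w, P (z + w)%C = P z + P w) ->
    (forall z, Rabs (P z) <= Cmod z) -> is_series (fun n => P (u n)) (P l)).
  { intros P Padd Pbd.
    assert (P0 : P (RtoC 0) = 0)
      by (generalize (Padd (RtoC 0) (RtoC 0)); rewrite Cplus_0_l; lra).
    assert (Popp : forall z, P (- z)%C = - P z).
    { intros z; generalize (Padd z (- z)%C); rewrite Cplus_opp_r, P0; lra. }
    apply (filterlim_locally (F := eventually) (U := R_UniformSpace)); intros eps.
    generalize (proj1 (filterlim_locally_ball_norm (F := eventually) (U := C_NormedModule)
      (sum_n u) l) Hl eps); apply filter_imp; intros n Hn.
    change (Rabs (sum_n (fun n => P (u n)) n - P l) < eps).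
    change (Cmod (sum_n u n - l)%C < eps) in Hn.
    replace (sum_n (fun n => P (u n)) n) with (P (sum_n (G := C_AbelianGroup) u n)).
    - unfold Rminus; rewrite <- Popp, <- Padd; eapply Rle_lt_trans; [apply Pbd | exact Hn].
    - clear Hn; induction n as [| n IH]; [now rewrite !sum_O |].
      rewrite !sum_Sn; etransitivity; [apply Padd |]; now rewrite IH. }
  unfold CSeries; rewrite (is_series_unique _ _ (Hs Re ltac:(reflexivity) re_le_Cmod)),
    (is_series_unique _ _ (Hs Im ltac:(reflexivity) im_le_Cmod)).
  now destruct l.
Qed.

Lemma disk_pow_bound (c : nat -> C) (z : C) :
  ex_series (fun n => Cmod (c n)) -> disk z -> ex_series (fun n => Cmod (c n * z ^ n)%C).
Proof.
  intros Hc Hz; apply (ex_series_nonneg_le _ (fun n => Cmod (c n))); [| assumption].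
  intros n; split; [apply Cmod_ge_0 |].
  rewrite Cmod_mult, Cmod_pow.
  assert (0 <= Cmod z) by apply Cmod_ge_0.
  assert (0 <= Cmod (c n)) by apply Cmod_ge_0.
  assert (Cmod z ^ n <= 1) by (rewrite <- (pow1 n); apply pow_incr; unfold disk in Hz; lra).
  nra.
Qed.

Lemma has_expansion_CPSeries (c : nat -> C) :
  ex_series (fun n => Cmod (c n)) -> has_expansion (CPSeries c) c.
Proof.
  intros Hc z Hz.
  eapply is_series_ext; [| exact (is_series_CSeries _ (disk_pow_bound c z Hc Hz))].
  intros n; exact (Cmult_comm (c n) (z ^ n)%C).
Qed.

Lemma CSeries_components (u : nat -> C) :
  ex_series (fun n => Cmod (u n)) ->
  ex_series (fun n => Re (u n)) /\ ex_series (fun n => Im (u n)).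
Proof.
  intros Hu; split;
    apply (ex_series_le (K := R_AbsRing) (V := R_CompleteNormedModule) _ (fun n => Cmod (u n)));
    try assumption; intros n; [apply re_le_Cmod | apply im_le_Cmod].
Qed.

Lemma CSeries_ext (u v : nat -> C) : (forall n, u n = v n) -> CSeries u = CSeries v.
Proof.
  intros H; unfold CSeries; f_equal; apply Series_ext; intros n; now rewrite H.
Qed.

Lemma CSeries_incr_1 (u : nat -> C) :
  ex_series (fun n => Cmod (u n)) ->
  CSeries u = (u O + CSeries (fun n => u (S n)))%C.
Proof.
  intros Hu; destruct (CSeries_components u Hu) as [H1 H2].
  unfold CSeries, Cplus; simpl.
  now rewrite (Series_incr_1 _ H1), (Series_incr_1 _ H2).
Qed.

Lemma CSeries_conj (u : nat -> C) : Cconj (CSeries u) = CSeries (fun n => Cconj (u n)).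
Proof.
  unfold CSeries, Cconj; simpl; f_equal; now rewrite <- Series_opp.
Qed.

(** For k > 0 the factor 1-nk is eventually nonpositive, so Q_n >= 1. For k = 0, Q_n = 1 -
    lambda(n+1) is eventually below -1 when lambda > 0, and is constantly 1 when lambda = 0. *)
Lemma psi_factor_eventually (lambda k : R) :
  0 <= lambda -> 0 <= k ->
  exists N, forall n, (N <= n)%nat -> 1 <= Rabs (psi_factor lambda k n).
Proof.
  intros Hl Hk; unfold psi_factor.
  destruct (Rle_lt_or_eq_dec 0 k Hk) as [Hk0 | <-].
  - destruct (INR_archimed k 1 Hk0) as [N HN]; exists N; intros n Hn.
    apply le_INR in Hn.
    assert (INR N * k <= INR n * k) by (apply Rmult_le_compat_r; lra).
    assert (0 <= INR n) by apply pos_INR.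
    assert (0 <= lambda * (INR n + 1)) by (apply Rmult_le_pos; lra).
    rewrite Rabs_pos_eq; nra.
  - destruct (Rle_lt_or_eq_dec 0 lambda Hl) as [Hl0 | <-].
    + destruct (INR_archimed lambda 2 Hl0) as [N HN]; exists N; intros n Hn.
      apply le_INR in Hn.
      assert (INR N * lambda <= INR n * lambda) by (apply Rmult_le_compat_r; lra).
      rewrite Rabs_left1; lra.
    + exists O; intros n _; rewrite Rmult_0_l, Rmult_0_l, Rminus_0_r, Rabs_R1; lra.
Qed.

Lemma ext_z_eq (k lambda nu : R) (gamma : nat -> C) (n : nat) :
  ext_z k lambda nu gamma n = (gamma n * RtoC (/ (phi_factor lambda k n * omega_ratio nu n)))%C.
Proof.
  unfold ext_z, phi_factor, omega_ratio; do 2 f_equal.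
  unfold Rdiv; rewrite !Rinv_mult, Rinv_inv; ring.
Qed.

Lemma ext_zbar_eq (k lambda nu : R) (delta : nat -> C) (n : nat) :
  ext_zbar k lambda nu delta n
  = (delta n * RtoC (/ (Rabs (psi_factor lambda k n) * omega_ratio nu n)))%C.
Proof.
  unfold ext_zbar, psi_factor, omega_ratio; do 2 f_equal.
  unfold Rdiv; rewrite !Rinv_mult, Rinv_inv; ring.
Qed.

(** * Sharpness *)

Lemma phi_term_ext (k lambda nu : R) (gamma : nat -> C) (m : nat) :
  0 <= nu < 1 -> 0 <= lambda -> 0 <= k ->
  phi_term k lambda nu (ext_a k lambda nu gamma) m = Cmod (gamma (m + 2)%nat).
Proof.
  intros Hnu Hl Hk; unfold phi_term.
  assert (Hn : (1 <= m + 2)%nat) by lia.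
  assert (Hc := omega_ratio_bounds nu _ Hnu Hn).
  assert (Hp := phi_factor_ge_1 lambda k _ Hl Hk Hn).
  assert (E : ext_a k lambda nu gamma (m + 2) = ext_z k lambda nu gamma (m + 2))
    by (replace (m + 2)%nat with (S (S m)) by lia; reflexivity).
  rewrite E, phi_eq, ext_z_eq, Cmod_mult, Cmod_R.
  assert (P : 0 < phi_factor lambda k (m + 2) * omega_ratio nu (m + 2))
    by (apply Rmult_lt_0_compat; lra).
  rewrite Rabs_inv, Rabs_pos_eq by lra; field; lra.
Qed.

Lemma psi_term_ext (k lambda nu : R) (delta : nat -> C) (m : nat) :
  0 <= nu < 1 ->
  (psi_factor lambda k (m + 1) = 0 -> delta (m + 1)%nat = RtoC 0) ->
  psi_term k lambda nu (ext_b k lambda nu delta) m = Cmod (delta (m + 1)%nat).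
Proof.
  intros Hnu H0; unfold psi_term.
  assert (Hn : (1 <= m + 1)%nat) by lia.
  assert (Hc := omega_ratio_bounds nu _ Hnu Hn).
  assert (E : ext_b k lambda nu delta (m + 1) = Cconj (ext_zbar k lambda nu delta (m + 1)))
    by (replace (m + 1)%nat with (S m) by lia; reflexivity).
  rewrite E, Cmod_conj, psi_eq, ext_zbar_eq, Cmod_mult, Cmod_R, Rabs_mult.
  rewrite (Rabs_pos_eq (omega_ratio nu (m + 1))) by lra.
  (* A vanishing Q_n cannot be cancelled; there both sides are zero because delta_n is. *)
  destruct (Req_dec (psi_factor lambda k (m + 1)) 0) as [Z | Z].
  - rewrite (H0 Z), Cmod_0; ring.
  - apply Rabs_pos_lt in Z.
    assert (P : 0 < Rabs (psi_factor lambda k (m + 1)) * omega_ratio nu (m + 1))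
      by (apply Rmult_lt_0_compat; lra).
    rewrite Rabs_inv, (Rabs_pos_eq (_ * _)) by lra; field; lra.
Qed.

Lemma Rinv_le_1 (x : R) : 1 <= x -> 0 <= / x <= 1.
Proof.
  intros Hx; split; [left; apply Rinv_0_lt_compat; lra |].
  rewrite <- Rinv_1; apply Rinv_le_contravar; lra.
Qed.

Lemma ext_a_summable (k lambda nu : R) (gamma : nat -> C) :
  0 <= nu < 1 -> 0 <= lambda -> 0 <= k ->
  ex_series (fun m => Cmod (gamma (m + 2)%nat)) ->
  ex_series (fun n => Cmod (ext_a k lambda nu gamma n)).
Proof.
  intros Hnu Hl Hk Hg.
  apply (ex_series_incr_n (fun n => Cmod (ext_a k lambda nu gamma n)) 2).
  apply (ex_series_nonneg_le _ (fun m => Cmod (gamma (m + 2)%nat))); [| assumption].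
  intros m; split; [apply Cmod_ge_0 |].
  replace (m + 2)%nat with (2 + m)%nat by lia.
  assert (Hn : (1 <= 2 + m)%nat) by lia.
  assert (Hc := omega_ratio_bounds nu _ Hnu Hn).
  assert (Hp := phi_factor_ge_1 lambda k _ Hl Hk Hn).
  change (Cmod (ext_z k lambda nu gamma (2 + m)) <= Cmod (gamma (2 + m)%nat)).
  rewrite ext_z_eq, Cmod_mult, Cmod_R.
  destruct (Rinv_le_1 (phi_factor lambda k (2 + m) * omega_ratio nu (2 + m))) as [I0 I1];
    [nra |].
  rewrite Rabs_pos_eq by assumption.
  assert (0 <= Cmod (gamma (2 + m)%nat)) by apply Cmod_ge_0; nra.
Qed.

Lemma ext_b_summable (k lambda nu : R) (delta : nat -> C) :
  0 <= nu < 1 -> 0 <= lambda -> 0 <= k ->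
  ex_series (fun m => Cmod (delta (m + 1)%nat)) ->
  ex_series (fun n => Cmod (ext_b k lambda nu delta n)).
Proof.
  intros Hnu Hl Hk Hd.
  destruct (psi_factor_eventually lambda k Hl Hk) as [N HN].
  apply (ex_series_incr_n (fun n => Cmod (ext_b k lambda nu delta n)) 1).
  apply (ex_series_nonneg_le_eventually N _ (fun m => Cmod (delta (m + 1)%nat))); [| assumption].
  intros m Hm; split; [apply Cmod_ge_0 |].
  replace (m + 1)%nat with (1 + m)%nat by lia.
  assert (Hc := omega_ratio_bounds nu (1 + m) Hnu ltac:(lia)).
  assert (Hp := HN (1 + m)%nat ltac:(lia)).
  change (Cmod (Cconj (ext_zbar k lambda nu delta (1 + m))) <= Cmod (delta (1 + m)%nat)).
  rewrite Cmod_conj, ext_zbar_eq, Cmod_mult, Cmod_R.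
  destruct (Rinv_le_1 (Rabs (psi_factor lambda k (1 + m)) * omega_ratio nu (1 + m))) as [I0 I1];
    [nra |].
  rewrite Rabs_pos_eq by assumption.
  assert (0 <= Cmod (delta (1 + m)%nat)) by apply Cmod_ge_0; nra.
Qed.

Lemma summable_disk_summable (c : nat -> C) :
  ex_series (fun n => Cmod (c n)) -> disk_summable (fun n => Cmod (c n)).
Proof.
  intros Hc r Hr; apply (ex_series_nonneg_le _ (fun n => Cmod (c n))); [| assumption].
  intros n.
  assert (0 <= Cmod (c n)) by apply Cmod_ge_0.
  assert (0 <= r ^ n) by (apply pow_le; lra).
  assert (r ^ n <= 1) by (rewrite <- (pow1 n); apply pow_incr; lra).
  nra.
Qed.

Lemma extremal_canonical_rep (k lambda nu : R) (gamma delta : nat -> C) :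
  ex_series (fun n => Cmod (ext_a k lambda nu gamma n)) ->
  ex_series (fun n => Cmod (ext_b k lambda nu delta n)) ->
  canonical_rep (extremal k lambda nu gamma delta)
    (CPSeries (ext_a k lambda nu gamma)) (CPSeries (ext_b k lambda nu delta))
    (ext_a k lambda nu gamma) (ext_b k lambda nu delta).
Proof.
  intros Ha Hb; do 3 (split; [reflexivity |]).
  split; [now apply has_expansion_CPSeries |].
  split; [now apply has_expansion_CPSeries |].
  intros z Hz.
  assert (Ha' := disk_pow_bound _ z Ha Hz).
  assert (Hb' := disk_pow_bound _ z Hb Hz).
  unfold CPSeries, extremal.
  rewrite (CSeries_incr_1 _ Ha'), (CSeries_incr_1 (fun n => _ (S n) * _)%C)
    by (now apply (ex_series_incr_n _ 1) in Ha').
  rewrite (CSeries_incr_1 _ Hb').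
  rewrite Cplus_conj, CSeries_conj.
  rewrite (CSeries_ext (fun m => ext_z k lambda nu gamma (m + 2) * z ^ (m + 2))%C
             (fun n => ext_a k lambda nu gamma (S (S n)) * z ^ S (S n))%C).
  2: { intros n; replace (n + 2)%nat with (S (S n)) by lia; reflexivity. }
  rewrite (CSeries_ext (fun m => ext_zbar k lambda nu delta (m + 1) * Cconj z ^ (m + 1))%C
             (fun n => Cconj (ext_b k lambda nu delta (S n) * z ^ S n))%C).
  2: { intros n; replace (n + 1)%nat with (S n) by lia.
       rewrite Cmult_conj, Cpow_conj; f_equal; symmetry; apply Cconj_conj. }
  cbn [ext_a ext_b Cpow].
  set (X := CSeries _); set (Y := CSeries _).
  replace (Cconj (RtoC 0 * 1)) with (RtoC 0)
    by (rewrite Cmult_0_l; unfold Cconj, RtoC; simpl; now rewrite Ropp_0).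
  ring.
Qed.

(** An Abel limit made easy by nonnegativity: for fixed N, r^(N+1) times the partial sum is at most
    [U]. Let r tend to 1 first, then N to infinity. *)
Lemma Series_le_of_disk_le (w : nat -> R) (U : R) :
  (forall n, 0 <= w n) -> ex_series w ->
  (forall r, 0 < r < 1 -> Series (fun n => w n * r ^ S n) <= U) -> Series w <= U.
Proof.
  intros Hw Hex HU.
  assert (P : forall N r, 0 < r < 1 -> r ^ S N * sum_n w N <= U).
  { intros N r Hr; eapply Rle_trans; [| apply (HU r Hr)].
    assert (Hex' : ex_series (fun n => w n * r ^ S n)).
    { apply (ex_series_nonneg_le _ w); [| assumption]; intros n.
      assert (0 <= r ^ S n) by (apply pow_le; lra).
      assert (r ^ S n <= 1) by (rewrite <- (pow1 (S n)); apply pow_incr; lra).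
      specialize (Hw n); nra. }
    apply Rle_trans with (sum_n (fun n => w n * r ^ S n) N).
    - rewrite <- (sum_n_mult_l (K := R_Ring)), !sum_n_Reals.
      apply sum_Rle; intros n Hn; unfold mult; simpl.
      rewrite (Rmult_comm (w n)); apply Rmult_le_compat_r; [apply Hw |].
      change (r ^ S N <= r ^ S n).
      replace (S N) with (S n + (N - n))%nat by lia; rewrite pow_add.
      rewrite <- (Rmult_1_r (r ^ S n)) at 2; apply Rmult_le_compat_l; [apply pow_le; lra |].
      rewrite <- (pow1 (N - n)); apply pow_incr; lra.
    - rewrite sum_n_Reals; apply sum_incr.
      + apply is_lim_seq_Reals, (is_lim_seq_ext (sum_n (fun n => w n * r ^ S n))).
        * intros n; apply sum_n_Reals.
        * exact (Series_correct _ Hex').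
      + intros n; apply Rmult_le_pos; [apply Hw | apply pow_le; lra]. }
  assert (Q : forall N, sum_n w N <= U).
  { intros N.
    assert (C : filterlim (fun r => r ^ S N * sum_n w N) (at_left 1) (locally (sum_n w N))).
    { assert (C : continuous (fun r => r ^ S N * sum_n w N) 1)
        by (apply (ex_derive_continuous (fun r => r ^ S N * sum_n w N)); auto_derive; auto).
      unfold continuous in C; rewrite pow1, Rmult_1_l in C.
      eapply filterlim_filter_le_1; [apply filter_le_within | exact C]. }
    refine (filterlim_le (F := at_left 1) _ (fun _ => U) (sum_n w N) U _ C (filterlim_const _)).
    exists (mkposreal 1 Rlt_0_1); intros r Hr Hr1; apply P.
    apply Rabs_def2 in Hr; unfold minus, plus, opp in Hr; simpl in Hr; lra. }
  refine (is_lim_seq_le (sum_n w) (fun _ => U) (Series w) U Q _ (is_lim_seq_const U)).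
  exact (Series_correct _ Hex).
Qed.

Definition sharp_gamma (gamma : nat -> C) (n : nat) : C := RtoC (- Cmod (gamma n)).

(** After normalisation the term at z = r carries Q_n/|Q_n|, so the sign of delta_n must oppose that
    of Q_n to give -|delta_n|. Since P_n > 0, a negative gamma_n always suffices. *)
Definition sharp_delta (lambda k : R) (delta : nat -> C) (n : nat) : C :=
  if Rlt_dec (psi_factor lambda k n) 0 then RtoC (Cmod (delta n)) else RtoC (- Cmod (delta n)).

Lemma sharp_gamma_Cmod (gamma : nat -> C) (n : nat) :
  Cmod (sharp_gamma gamma n) = Cmod (gamma n).
Proof.
  unfold sharp_gamma; rewrite Cmod_R, Rabs_Ropp; apply Rabs_pos_eq, Cmod_ge_0.
Qed.

Lemma sharp_delta_Cmod (lambda k : R) (delta : nat -> C) (n : nat) :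
  Cmod (sharp_delta lambda k delta n) = Cmod (delta n).
Proof.
  unfold sharp_delta; destruct Rlt_dec; rewrite Cmod_R, ?Rabs_Ropp;
    apply Rabs_pos_eq, Cmod_ge_0.
Qed.

Lemma ext_params_ext (beta lambda k : R) (gamma delta gamma' delta' : nat -> C) :
  (forall n, Cmod (gamma' n) = Cmod (gamma n)) ->
  (forall n, Cmod (delta' n) = Cmod (delta n)) ->
  ext_params beta lambda k gamma delta -> ext_params beta lambda k gamma' delta'.
Proof.
  intros Hg Hd (H0 & Hgs & Hds & Hs); repeat split.
  - intros n Hn Z; apply Cmod_eq_0; rewrite Hd, (H0 n Hn Z); apply Cmod_0.
  - eapply ex_series_ext; [| exact Hgs]; intros; now rewrite Hg.
  - eapply ex_series_ext; [| exact Hds]; intros; now rewrite Hd.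
  - rewrite <- Hs; f_equal; apply Series_ext; intros; auto.
Qed.

Lemma extremal_coefficient_bound (k beta lambda nu : R) (gamma delta : nat -> C) :
  0 <= nu < 1 -> 0 <= lambda -> 0 <= k -> ext_params beta lambda k gamma delta ->
  ex_series (phi_term k lambda nu (ext_a k lambda nu gamma)) /\
  ex_series (psi_term k lambda nu (ext_b k lambda nu delta)) /\
  Series (phi_term k lambda nu (ext_a k lambda nu gamma))
    + Series (psi_term k lambda nu (ext_b k lambda nu delta)) = 1 - beta.
Proof.
  intros Hnu Hl Hk (H0 & Hgs & Hds & Hs).
  assert (Ep := fun m => phi_term_ext k lambda nu gamma m Hnu Hl Hk).
  assert (Eq := fun m => psi_term_ext k lambda nu delta m Hnu (H0 (m + 1)%nat ltac:(lia))).
  repeat split.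
  - eapply ex_series_ext; [| exact Hgs]; intros; symmetry; apply Ep.
  - eapply ex_series_ext; [| exact Hds]; intros; symmetry; apply Eq.
  - now rewrite (Series_ext _ _ Ep), (Series_ext _ _ Eq).
Qed.

Lemma hm_term_sharp (k beta lambda nu : R) (gamma delta : nat -> C) (r : R) (n : nat) :
  0 <= nu < 1 -> 0 <= lambda -> 0 <= k -> 0 < r < 1 ->
  ext_params beta lambda k gamma delta -> (1 <= n)%nat ->
  hm_term lambda k nu (ext_a k lambda nu (sharp_gamma gamma))
    (ext_b k lambda nu (sharp_delta lambda k delta)) r 0 n
  = r ^ n / r * ((if n =? 1 then 1 else - Cmod (gamma n)) - Cmod (delta n)).
Proof.
  intros Hnu Hl Hk Hr (H0 & _) Hn.
  assert (Hc := omega_ratio_bounds nu n Hnu Hn).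
  assert (Hp := phi_factor_ge_1 lambda k n Hl Hk Hn).
  unfold hm_term; rewrite !Rmult_0_r, sin_0, cos_0, !Omega_coef_eq, !Re_RtoC_mult, !Rmult_0_r,
    !Rminus_0_r, !Rmult_1_r.
  f_equal; unfold Rminus; f_equal.
  - destruct n as [| [| n]]; [lia | |].
    + rewrite omega_ratio_1 by assumption; unfold phi_factor; simpl; ring.
    + change (ext_a k lambda nu (sharp_gamma gamma) (S (S n)))
        with (ext_z k lambda nu (sharp_gamma gamma) (S (S n))).
      rewrite ext_z_eq; unfold sharp_gamma; simpl Nat.eqb; cbv iota.
      unfold Re, Cmult, RtoC; simpl fst; simpl snd.
      field; lra.
  - replace (Re (ext_b k lambda nu (sharp_delta lambda k delta) n))
      with (Re (ext_zbar k lambda nu (sharp_delta lambda k delta) n))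
      by (destruct n; [lia | reflexivity]).
    rewrite ext_zbar_eq; unfold sharp_delta.
    destruct (Req_dec (psi_factor lambda k n) 0) as [Z | Z].
    + rewrite (H0 n Hn Z), Z, Cmod_0; ring.
    + destruct Rlt_dec as [L | L]; unfold Re, Cmult, RtoC; simpl fst; simpl snd.
      * rewrite Rabs_left by assumption; field; lra.
      * rewrite Rabs_pos_eq by lra; field; lra.
Qed.

(** On the positive radius the expression is 1 - |delta_1| minus a series with nonnegative terms
    times powers of r, and at r = 1 this would equal beta. A lower bound [l] therefore bounds that
    series for all r < 1, hence also its sum at 1. *)
Lemma HM_re_sharp_glb (k beta lambda nu : R) (gamma delta : nat -> C) (l : R) :
  0 <= nu < 1 -> 0 <= lambda -> 0 <= k -> ext_params beta lambda k gamma delta ->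
  (forall r, 0 < r < 1 ->
     l <= HM_re lambda k nu (ext_a k lambda nu (sharp_gamma gamma))
            (ext_b k lambda nu (sharp_delta lambda k delta)) r 0) ->
  l <= beta.
Proof.
  intros Hnu Hl Hk Hpar Hlb.
  assert (Hpar' := ext_params_ext _ _ _ _ _ _ _ (sharp_gamma_Cmod gamma)
                     (sharp_delta_Cmod lambda k delta) Hpar).
  set (a := ext_a k lambda nu (sharp_gamma gamma)) in *.
  set (b := ext_b k lambda nu (sharp_delta lambda k delta)) in *.
  assert (Ha : disk_summable (fun n => Cmod (a n)))
    by (apply summable_disk_summable, ext_a_summable; try assumption; apply Hpar').
  assert (Hb : disk_summable (fun n => Cmod (b n)))
    by (apply summable_disk_summable, ext_b_summable; try assumption; apply Hpar').
  assert (HT := fun r n Hr => hm_term_sharp k beta lambda nu gamma delta r n Hnu Hl Hk Hr Hpar).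
  destruct Hpar as (_ & Hgs & Hds & Hs).
  rewrite (Series_incr_1 _ Hds) in Hs.
  assert (Hds' : ex_series (fun n => Cmod (delta (S n + 1)%nat)))
    by (now apply (ex_series_incr_n (fun m => Cmod (delta (m + 1)%nat)) 1)).
  rewrite Rplus_comm, Rplus_assoc, <- Series_plus in Hs by assumption.
  assert (W : Series (fun n => Cmod (delta (S n + 1)%nat) + Cmod (gamma (n + 2)%nat))
              <= 1 - Cmod (delta 1%nat) - l); [| change (0 + 1)%nat with 1%nat in Hs; lra].
  apply Series_le_of_disk_le.
  - intros n; apply Rplus_le_le_0_compat; apply Cmod_ge_0.
  - now apply ex_series_plus_R.
  - intros r Hr; specialize (Hlb r Hr).
    assert (HS := HM_re_is_series lambda k nu a b r 0 Hnu Hr eq_refl eq_refl Ha Hb).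
    set (T := hm_term lambda k nu a b r 0) in *.
    assert (Hex : ex_series T) by (eexists; exact HS).
    apply is_series_unique in HS; rewrite <- HS in Hlb.
    rewrite (Series_incr_1 T Hex), (Series_incr_1 (fun n => T (S n))) in Hlb
      by (now apply (ex_series_incr_n T 1)).
    assert (T0 : T O = 0).
    { unfold T, hm_term; rewrite !Omega_coef_eq; unfold Cmult, Re, Im; simpl; ring. }
    assert (E2 : Series (fun n => T (S (S n)))
      = - Series (fun n => (Cmod (delta (S n + 1)%nat) + Cmod (gamma (n + 2)%nat)) * r ^ S n)).
    { rewrite <- Series_opp; apply Series_ext; intros n.
      unfold T, a, b; rewrite HT by (assumption || lia).
      replace (S n + 1)%nat with (S (S n)) by lia.
      replace (n + 2)%nat with (S (S n)) by lia.
      simpl; field; lra. }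
    assert (E1 : T 1%nat = 1 - Cmod (delta 1%nat)).
    { unfold T, a, b; rewrite HT by (assumption || lia); simpl; field; lra. }
    rewrite E2, E1, T0 in Hlb; lra.
Qed.

Theorem theorem2p1 (k beta lambda nu : R)
    (hk : 0 <= k <= 1) (hbeta : 0 < beta <= 1) (hlambda : 0 <= lambda) (hnu : 0 <= nu < 1) :
  (forall (f h g : C -> C) (a b : nat -> C),
     classH f -> canonical_rep f h g a b -> Cmod (b 1%nat) < 1 ->
     ex_series (phi_term k lambda nu a) ->
     ex_series (psi_term k lambda nu b) ->
     Series (phi_term k lambda nu a) + Series (psi_term k lambda nu b) < 1 - beta ->
     classHM beta lambda k nu f)
  /\
  (* sharpness: every member of the family attains equality in the coefficient
     bound, and for suitable arguments of the parameters (whatever their moduli)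
     the constant beta in the conclusion is exactly the infimum *)
  (forall gamma delta : nat -> C,
     ext_params beta lambda k gamma delta ->
     ((exists h g : C -> C,
         canonical_rep (extremal k lambda nu gamma delta) h g
           (ext_a k lambda nu gamma) (ext_b k lambda nu delta)) /\
      ex_series (phi_term k lambda nu (ext_a k lambda nu gamma)) /\
      ex_series (psi_term k lambda nu (ext_b k lambda nu delta)) /\
      Series (phi_term k lambda nu (ext_a k lambda nu gamma))
        + Series (psi_term k lambda nu (ext_b k lambda nu delta)) = 1 - beta) /\
     exists gamma' delta' : nat -> C,
       (forall n, Cmod (gamma' n) = Cmod (gamma n)) /\
       (forall n, Cmod (delta' n) = Cmod (delta n)) /\
       is_glb_Rbar
         (fun x => exists r theta, 0 < r < 1 /\
            x = HM_re lambda k nu (ext_a k lambda nu gamma') (ext_b k lambda nu delta') r theta)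
         (Finite beta)).
Proof.
  destruct hk as [hk0 _]; split.
  - intros f h g a b Hf Hrep _ Hphi Hpsi Hlt; split; [assumption |].
    exists h, g, a, b; split; [assumption |].
    destruct Hrep as (Ha0 & Ha1 & Hb0 & Ha & Hb & _).
    intros r t Hr.
    eapply Rlt_le_trans; [| apply HM_re_lower_bound; eauto using expansion_disk_summable].
    lra.
  - intros gamma delta Hpar; split; [split |].
    + do 2 eexists; apply extremal_canonical_rep;
        [apply ext_a_summable | apply ext_b_summable]; try assumption; apply Hpar.
    + now apply extremal_coefficient_bound.
    + exists (sharp_gamma gamma), (sharp_delta lambda k delta).
      split; [apply sharp_gamma_Cmod |]; split; [apply sharp_delta_Cmod |].
      assert (Hpar' := ext_params_ext _ _ _ _ _ _ _ (sharp_gamma_Cmod gamma)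
                         (sharp_delta_Cmod lambda k delta) Hpar).
      split.
      * intros x (r & t & Hr & ->).
        destruct (extremal_coefficient_bound k beta lambda nu _ _ hnu hlambda hk0 Hpar')
          as (Hphi & Hpsi & Hsum).
        simpl; replace beta with (1 - (1 - beta)) by ring; rewrite <- Hsum.
        apply HM_re_lower_bound; try assumption; try reflexivity;
          apply summable_disk_summable; [apply ext_a_summable | apply ext_b_summable];
          try assumption; apply Hpar'.
      * intros [l | |] Hlb; simpl; try exact I.
        -- apply (HM_re_sharp_glb k beta lambda nu gamma delta); try assumption.
           intros r Hr.
           apply (Hlb (HM_re lambda k nu (ext_a k lambda nu (sharp_gamma gamma))
                         (ext_b k lambda nu (sharp_delta lambda k delta)) r 0)).
           now exists r, 0.
        (* Plus infinity is no lower bound of a nonempty set of reals; the point r = 1/2, theta = 0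
           is an arbitrary witness. *)
        -- apply (Hlb (HM_re lambda k nu (ext_a k lambda nu (sharp_gamma gamma))
                         (ext_b k lambda nu (sharp_delta lambda k delta)) (1 / 2) 0)).
           exists (1 / 2), 0; split; [lra | reflexivity].
Qed.
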